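(* For each of the problems minimum, sorting, and MST under uncertainty (with predictions), there is an algorithm that is $1.5$-consistent and $2$-robust.
   Context: Each uncertain element $i$ has an interval $I_i$ that is open $(L_i,U_i)$ or trivial $\{w_i\}$, an unknown true value $w_i\in I_i$ and a given predicted value $\bar w_i\in I_i$; a query of $I_i$ reveals $w_i$. Minimum problem: given intervals $\mathcal{I}$ and a family $\mathcal{S}$ of subsets, determine for each $S\in\mathcal{S}$ an element of minimum true value. Sorting problem: determine for each $S\in\mathcal{S}$ the order of its elements by true value. MST problem: graph $G=(V,E)$ with an interval and prediction per edge weight; determine a spanning tree that is an MST for the true weights. A query set $Q$ is feasible if the answer is the same for every assignment of values in the intervals that agrees with the true values on $Q$; $\mathrm{opt}$ is the minimum size of a feasible query set. An algorithm knows intervals and predictions, queries adaptively, and stops when its queries form a feasible set; $|\mathrm{ALG}|$ is its number of queries. It is $\alpha$-consistent if $|\mathrm{ALG}|\le\alpha\cdot\mathrm{opt}$ on every instance with all predictions correct, and $\beta$-robust if $|\mathrm{ALG}|\le\beta\cdot\mathrm{opt}$ on every instance. *)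

(* Defs.v *)
From HB Require Import structures.
From mathcomp Require Import all_boot all_order all_algebra.
From mathcomp Require Import boolp reals.

Set Implicit Arguments.
Unset Strict Implicit.
Unset Printing Implicit Defensive.

Import Order.TTheory GRing.Theory Num.Theory.
Local Open Scope ring_scope.

Definition open_or_trivial (R : realType) (J : interval R) : Prop :=
  (exists L U : R, J = `]L, U[) \/ (exists v : R, J = `[v, v]).

(* What is known before any query, apart from the combinatorial input. *)
Record known (R : realType) (T : finType) := Known {
  itv_of : T -> interval R;
  predicted : T -> R;
  itv_ofP : forall i, open_or_trivial (itv_of i);
  predictedP : forall i, predicted i \in itv_of i }.

(* [input T] is the combinatorial input over the uncertain elements [T] (a
   family of sets, a graph); [correct x a] says that [a] is a right answer when
   the values of the elements are given by [x]. *)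
Record problem (R : realType) := Problem {
  input : finType -> Type;
  answer : forall T : finType, input T -> Type;
  correct : forall (T : finType) (P : input T), (T -> R) -> answer P -> Prop }.

Record instance (R : realType) (pb : problem R) := Instance {
  elt : finType;
  inp : input pb elt;
  knw : known R elt;
  value : elt -> R;
  valueP : forall i, value i \in itv_of knw i }.

Section Queries.
Variables (R : realType) (pb : problem R).
Implicit Type I : instance pb.

(* Several answers may be right when values are tied; "the answer is the same
   for all assignments" means that one answer is right for all of them. *)
Definition feasible I (Q : {set elt I}) : Prop :=
  exists a : answer (inp I), forall x : elt I -> R,
    (forall i, x i \in itv_of (knw I) i) ->
    (forall i, i \in Q -> x i = value i) ->
    correct x a.

(* The default [#|elt I|] of the minimum is the size of the set of all
   elements, which is feasible as soon as the problem has an answer for the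
   true values. *)
Definition opt I : nat :=
  \big[minn/#|elt I|]_(Q : {set elt I} | `[< feasible Q >]) #|Q|.

(* A deterministic adaptive query strategy: from the combinatorial input, the
   intervals, the predictions and the list of queries made so far with their
   results, it chooses the next query, or stops with [None]. *)
Definition strategy : Type :=
  forall T : finType, input pb T -> known R T -> seq (T * R) -> option T.

Definition next_query (s : strategy) I (h : seq (elt I * R)) : option (elt I) :=
  s (elt I) (inp I) (knw I) h.

Fixpoint history (s : strategy) I (k : nat) : seq (elt I * R) :=
  if k is k'.+1 then
    let h := history s I k' in
    if next_query s h is Some i then rcons h (i, value i) else h
  else [::].

Definition queried I (h : seq (elt I * R)) : {set elt I} :=
  [set i in [seq p.1 | p <- h]].

Record algorithm := Algorithm {
  strat : strategy;
  stopsP : forall I k, next_query strat (history strat I k) = None <->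
                       feasible (queried (history strat I k));
  haltsP : forall I, exists k, next_query strat (history strat I k) == None }.

(* |ALG|: the first step at which the algorithm stops. *)
Definition num_queries (A : algorithm) I : nat := ex_minn (haltsP A I).

Definition predictions_correct I : Prop :=
  forall i, predicted (knw I) i = value i.

Definition consistent (alpha : R) (A : algorithm) : Prop :=
  forall I, predictions_correct I ->
    (num_queries A I)%:R <= alpha * (opt I)%:R.

Definition robust (beta : R) (A : algorithm) : Prop :=
  forall I, (num_queries A I)%:R <= beta * (opt I)%:R.

End Queries.

(* An empty set has no element of minimum value. *)
Record nonempty_family (T : finType) := NonemptyFamily {
  family :> {set {set T}};
  family_nonempty : set0 \notin family }.

(* An answer names an element for each set of the family; its values outside
   the family are irrelevant. *)
Definition minimum_problem (R : realType) : problem R :=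
  @Problem R nonempty_family
    (fun T _ => {set T} -> option T)
    (fun T F x a => forall S : {set T}, S \in family F ->
       exists2 i, a S = Some i & i \in S /\ forall j, j \in S -> x i <= x j).

(* An answer lists each set of the family in nondecreasing order of value. *)
Definition sorting_problem (R : realType) : problem R :=
  @Problem R (fun T => {set {set T}})
    (fun T _ => {set T} -> seq T)
    (fun T F x a => forall S : {set T}, S \in F ->
       perm_eq (a S) (enum S) /\ sorted (fun i j => x i <= x j) (a S)).

Section Trees.
Variables (T V : finType) (ends : T -> {set V}).

Definition adjacent (A : {set T}) : rel V :=
  fun u v => [exists e in A, ends e == [set u; v]].

Definition spans (A : {set T}) : Prop := forall u v, connect (adjacent A) u v.

(* The sequence [(v1, e1); ...; (vk, ek)] encodes the cycle in which [ei] joins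
   [vi] to [v(i+1)], indices modulo [k]. Two parallel edges form a cycle. *)
Definition is_cycle (A : {set T}) (c : seq (V * T)) : Prop :=
  [/\ c != [::], uniq [seq p.1 | p <- c], uniq [seq p.2 | p <- c],
      {subset [seq p.2 | p <- c] <= A}
    & cycle (fun p q => ends p.2 == [set p.1; q.1]) c].

Definition spanning_tree (A : {set T}) : Prop :=
  spans A /\ forall c, ~ is_cycle A c.

End Trees.

(* Finite connected loopless graphs with edge set [T]; parallel edges are
   allowed, and the simple graphs are those with [ends] injective. *)
Record graph (T : finType) := Graph {
  vertex : finType;
  ends : T -> {set vertex};
  ends_card : forall e, #|ends e| = 2%N;
  connected : spans ends setT }.

Definition mst (R : realType) (T : finType) (G : graph T) (x : T -> R)
    (A : {set T}) : Prop :=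
  spanning_tree (@ends T G) A /\
  forall B : {set T}, spanning_tree (@ends T G) B ->
    \sum_(e in A) x e <= \sum_(e in B) x e.

Definition mst_problem (R : realType) : problem R :=
  @Problem R graph (fun T _ => {set T}) (fun T G x A => mst G x A).

(* Main.v *)
Require Import Defs.
From mathcomp Require Import all_boot all_order all_algebra.
From mathcomp Require Import boolp reals.
From mathcomp Require Import zify lra.
Import Order.TTheory GRing.Theory Num.Theory.

Set Implicit Arguments.
Unset Strict Implicit.
Unset Printing Implicit Defensive.

(** A set of queries that leaves no further element forced and is still not
   feasible has a _witness pair_, which every feasible set meets; so querying
   forced elements and witness pairs is 2-competitive, and this is what is done
   as soon as a prediction is refuted. It remains to stay ready for this while
   the predictions hold.

   Let [M] be the set of elements that every feasible set contains if the
   predictions are right. Two elements of [M] that form a witness pair are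
   queried together, and an element outside [M] whose predicted value makes two
   elements of [M] forced is queried with them: 3 queries, of which 2 are
   mandatory. Otherwise every remaining [a] in [M] has a partner [d a] of its
   own outside [M], such that [{a, d a}] is a witness pair and the predicted
   value of [d a] makes [a] forced; the other elements form a vertex cover
   problem, for which we take a minimum cover [C0]. Let [K] be the set of the
   partners that are matched into [C0]. If [d a] is in [C0] or [K], then [d a]
   is queried before [a], which confirms that [a] is forced, so that [a] pays
   for both and [d a] is free to pay for its match in [C0]; otherwise only [a]
   is queried, and [d a] is kept as its witness. With [k] elements [a] this
   takes at most [k + #|C0| + #|K| <= 3/2 * (k + #|C0|)] queries, since
   [#|K| <= k] and [#|K| <= #|C0|].

   Sorting is the minimum problem on pairs. For minima, the edges of the cover
   problem are witness pairs. For spanning trees, the cover problem is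
   bipartite, with the edges of a tree that is minimum for the lower and for
   the upper limits on one side; [C0] is then matched into its complement, and
   querying it by decreasing upper limits in the tree and increasing lower
   limits outside makes each matched pair a witness pair in its turn, until a
   prediction is refuted and the matches are queried as well. *)

(** * Matchings and vertex covers *)

Section Matching.
Variables (T : finType) (r : rel T).
Implicit Types A B X Y : {set T}.

Definition nbrs B X := [set y in B | [exists x in X, r x y]].

Lemma nbrsP B X y :
  reflect (y \in B /\ exists2 x, x \in X & r x y) (y \in nbrs B X).
Proof.
rewrite inE; apply: (iffP andP) => -[yB].
  by move/exists_inP => [x xX rxy]; split=> //; exists x.
by case=> x xX rxy; split=> //; apply/exists_inP; exists x.
Qed.

Lemma nbrs_sub B X : nbrs B X \subset B.
Proof. by apply/subsetP => y /nbrsP[]. Qed.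

Lemma nbrsU B X Y : nbrs B (X :|: Y) = nbrs B X :|: nbrs B Y.
Proof.
apply/setP => y; rewrite in_setU; apply/nbrsP/orP.
  by case=> yB [x]; rewrite in_setU => /orP[] xX rxy;
    [left | right]; apply/nbrsP; split=> //; exists x.
by case=> /nbrsP[yB [x xX rxy]]; split=> //; exists x;
  rewrite // in_setU xX ?orbT.
Qed.

(** Induction on [#|A|]. If some nonempty proper subset [X] of [A] has no more neighbours than
    elements, [X] and [A :\: X] are matched separately; otherwise there is enough slack to match any
    adjacent pair [a], [b] and delete both. *)
Theorem Hall A B :
  (forall X, X \subset A -> (#|X| <= #|nbrs B X|)%N) ->
  exists h : T -> T, {in A &, injective h} /\
    forall x, x \in A -> h x \in B /\ r x (h x).
Proof.
have [n] := ubnP #|A|; elim: n => // n IHn in A B *; rewrite ltnS => leAn hallA.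
have [->|[a aA]] := set_0Vmem A.
  by exists id; split=> [x y|x]; rewrite inE.
case: (pselect (exists X, [/\ X \proper A, X != set0 & (#|nbrs B X| <= #|X|)%N])).
  case=> X [prX X0 tight].
  have sXA := proper_sub prX; have ltXA := proper_card prX.
  have [|Y sYX|h1 [inj1 h1P]] := IHn X B; first by lia.
    by apply: hallA; apply: subset_trans sYX sXA.
  have X_gt0 : (0 < #|X|)%N by rewrite card_gt0.
  have cAX := cardsID X A.
  have cIX : #|A :&: X| = #|X| by rewrite (setIidPr sXA).
  have [|Y|h2 [inj2 h2P]] := IHn (A :\: X) (B :\: nbrs B X); first by lia.
    rewrite subsetD => /andP[sYA dYX].
    (* Hall's condition for [X :|: Y] and the tightness of [X] leave [Y] enough neighbours outside
       those of [X]. *)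
    have := hallA (X :|: Y); rewrite subUset sXA sYA => /(_ isT).
    rewrite cardsU (_ : X :&: Y = set0); last first.
      by apply/eqP; rewrite setI_eq0 disjoint_sym.
    rewrite cards0 nbrsU => le1.
    have : nbrs B X :|: nbrs B Y \subset nbrs B X :|: nbrs (B :\: nbrs B X) Y.
      apply/subsetP => y; rewrite !in_setU; case/orP => [-> // | yY].
      case: (boolP (y \in nbrs B X)) => //= nyX; apply/nbrsP.
      by case/nbrsP: yY => yB ?; split=> //; rewrite in_setD nyX.
    move/subset_leq_card; have := cardsU (nbrs B X) (nbrs (B :\: nbrs B X) Y).
    by lia.
  exists (fun x => if x \in X then h1 x else h2 x); split; last first.
    move=> x xA; case: ifP => xX; first exact: h1P.
    have [|] := h2P x; first by rewrite in_setD xX.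
    by rewrite in_setD => /andP[].
  have h12 x y : x \in X -> y \in A -> y \notin X -> h1 x <> h2 y.
    move=> xX yA nyX e; have [|] := h2P y; first by rewrite in_setD nyX.
    rewrite in_setD -e => /andP[/negP nN _] _; case: nN; apply/nbrsP.
    by case: (h1P x xX) => ? ?; split=> //; exists x.
  move=> x y xA yA; case: ifPn => xX; case: ifPn => yX e.
  - exact: inj1.
  - by case: (h12 x y).
  - by case: (h12 y x).
  - by apply: inj2; rewrite // in_setD ?xX ?yX.
move=> slack.
have := hallA [set a]; rewrite sub1set aA cards1 => /(_ isT) /card_gt0P [b].
case/nbrsP => bB [_ /set1P-> rab].
have cA := cardsD1 a A; rewrite aA in cA.
have [|X|h [injh hP]] := IHn (A :\ a) (B :\ b); first by lia.
  move=> sXA; have [->|[x xX]] := set_0Vmem X; first by rewrite cards0.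
  have prX : X \proper A.
    apply/properP; split; first by apply: subset_trans sXA (subsetDl _ _).
    by exists a => //; apply/negP => /(subsetP sXA); rewrite !inE eqxx.
  have ltX : (#|X| < #|nbrs B X|)%N.
    rewrite ltnNge; apply/negP => le; apply: slack; exists X; split=> //.
    by apply/set0Pn; exists x.
  have : nbrs B X :\ b \subset nbrs (B :\ b) X.
    apply/subsetP => y; rewrite in_setD1 => /andP[yb /nbrsP[yB ?]].
    by apply/nbrsP; rewrite in_setD1 yb.
  move/subset_leq_card; have := cardsD1 b (nbrs B X).
  by case: (b \in _) => /=; lia.
exists (fun x => if x == a then b else h x); split; last first.
  move=> x xA; case: eqP => [-> //|/eqP xa].
  by have [|] := hP x; rewrite ?in_setD1 ?xa // => /andP[].
have hb y : y \in A -> y != a -> b <> h y.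
  move=> yA ya e; have [|] := hP y; first by rewrite in_setD1 ya.
  by rewrite in_setD1 -e eqxx.
move=> x y xA yA; case: eqP => [->|/eqP xa]; case: eqP => [->|/eqP ya] // e.
- by case: (hb y).
- by case: (hb x).
- by apply: injh; rewrite // in_setD1 ?xa ?ya.
Qed.

End Matching.

Section VertexCovers.
Variables (T : finType) (G : rel T).
Hypothesis Gsym : symmetric G.
Implicit Types U C X Y Z P K : {set T}.

Definition covers U C :=
  forall u w, u \in U -> w \in U -> G u w -> (u \in C) || (w \in C).

Definition min_cover U C :=
  [/\ C \subset U, covers U C
    & forall C', C' \subset U -> covers U C' -> (#|C| <= #|C'|)%N].

Lemma min_cover_exists U : exists C, min_cover U C.
Proof.
pose P C := (C \subset U) && `[< covers U C >].
have PU : P U by rewrite /P subxx; apply/asboolP => u w ->.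
case: (@arg_minnP _ U P (fun C => #|C|) PU) => C /andP[sCU /asboolP covC] minC.
by exists C; split=> // C' sC'U covC'; apply: minC; apply/andP; split=> //; apply/asboolP.
Qed.

(* Trading a set [X] of cover vertices for its neighbours outside the cover
   leaves a cover if [X] is independent. *)
Lemma min_cover_Hall U C X : min_cover U C -> X \subset C ->
  {in X &, forall u w, ~~ G u w} -> (#|X| <= #|nbrs G (U :\: C) X|)%N.
Proof.
move=> [sCU covC minC] sXC indX.
pose N := nbrs G (U :\: C) X.
have sNU : N \subset U by apply: subset_trans (nbrs_sub _ _ _) (subsetDl _ _).
have := minC ((C :\: X) :|: N); rewrite subUset sNU (subset_trans _ sCU) ?subsetDl //.
have cov : covers U (C :\: X :|: N).
  move=> u w uU wU Guw; have := covC u w uU wU Guw.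
  rewrite !in_setU !in_setD.
  wlog uC : u w uU wU Guw / u \in C => [hw|_].
    by case/orP => h; [apply: hw|rewrite orbC; apply: hw]; rewrite // ?h // Gsym.
  rewrite uC; case: (boolP (u \in X)) => //= uX.
  case: (boolP (w \in C)) => wC.
    case: (boolP (w \in X)) => wX; last by rewrite ?orbT.
    by move/negP: (indX u w uX wX).
  suff -> : w \in N by rewrite !orbT.
  by apply/nbrsP; rewrite in_setD wC wU; split=> //; exists u.
move=> /(_ isT cov) le; have := cardsID X C; rewrite (setIidPr sXC).
by have := cardsU (C :\: X) N; rewrite -/N; lia.
Qed.

(** Each side of a set [X] of cover vertices is independent, so [min_cover_Hall] applies to it; the
    neighbours of the two sides lie on opposite sides, so the counts add up to Hall's condition for
    [X]. *)
Lemma bipartite_matching U C (side : pred T) : min_cover U C ->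
  (forall u w, G u w -> side u != side w) ->
  exists h : T -> T, {in C &, injective h} /\
    forall c, c \in C -> h c \in U :\: C /\ G c (h c).
Proof.
move=> minC bip; apply: Hall => X sXC.
pose Xt := [set x in X | side x]; pose Xf := [set x in X | ~~ side x].
have eX : X = Xt :|: Xf.
  by apply/setP => x; rewrite !inE; case: (x \in X) => //=; case: (side x).
have le_one Z b : Z \subset X -> (forall z, z \in Z -> side z = b) ->
    (#|Z| <= #|nbrs G (U :\: C) Z|)%N.
  move=> sZX sideZ; apply: min_cover_Hall minC (subset_trans sZX sXC) _.
  move=> u w uZ wZ; apply/negP => /bip; rewrite (sideZ u uZ) (sideZ w wZ).
  by rewrite eqxx.
have let_ : (#|Xt| <= #|nbrs G (U :\: C) Xt|)%N.
  apply: (le_one _ true); last by move=> z; rewrite inE => /andP[].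
  by apply/subsetP => z; rewrite inE => /andP[].
have lef : (#|Xf| <= #|nbrs G (U :\: C) Xf|)%N.
  apply: (le_one _ false); last by move=> z; rewrite inE => /andP[_ /negbTE].
  by apply/subsetP => z; rewrite inE => /andP[].
have disjN : nbrs G (U :\: C) Xt :&: nbrs G (U :\: C) Xf = set0.
  apply/setP => y; rewrite in_set0 in_setI; apply/negP => /andP[].
  move=> /nbrsP[_ [x]]; rewrite inE => /andP[_ sx] /bip; rewrite sx => sy.
  move=> /nbrsP[_ [z]]; rewrite inE => /andP[_ /negbTE sz] /bip; rewrite sz.
  by move: sy; case: (side y).
have := cardsU Xt Xf; rewrite -eX.
have := cardsU (nbrs G (U :\: C) Xt) (nbrs G (U :\: C) Xf); rewrite -nbrsU -eX.
by rewrite disjN cards0; lia.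
Qed.

(* [K] is the part of [P] matched into [C] by a maximum matching: König's
   theorem says that the other vertices of [P] do not matter. *)
Lemma essential_part U C P : min_cover U C -> P \subset U :\: C ->
  exists K, [/\ K \subset P, (#|K| <= #|C|)%N
    & forall C1, C1 \subset U :\: (P :\: K) -> covers (U :\: (P :\: K)) C1 ->
      (#|C| <= #|C1|)%N].
Proof.
move=> [sCU covC minC] sP.
pose N Y := nbrs G C Y.
have N_le Y : (#|N Y| <= #|C|)%N by apply: subset_leq_card; apply: nbrs_sub.
(* A maximizer of [def] is a worst violation of Hall's condition; the summand [#|C|] keeps the
   truncated subtraction exact. *)
pose def Y := (#|Y| + (#|C| - #|N Y|))%N.
have [Y sYP maxY] : exists2 Y : {set T}, Y \subset P &
    forall Z, Z \subset P -> (def Z <= def Y)%N.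
  have P0 : [pred Z : {set T} | Z \subset P] set0 by rewrite inE sub0set.
  by case: (arg_maxnP def P0) => Y sY maxY; exists Y.
have indep u w : u \in P -> w \in U -> G u w -> w \in C.
  move=> uP wU Guw; have /setDP[uU nuC] := subsetP sP u uP.
  by have := covC u w uU wU Guw; rewrite (negbTE nuC).
(* [N Y] is matched back into [Y]: if some [X] in it had fewer than [#|X|] neighbours in [Y],
   deleting these from [Y] would increase [def]. *)
have [|h [injh hP]] := @Hall T G (N Y) Y.
  move=> X sX; pose Y' := Y :\: nbrs G Y X.
  have sY' : Y' \subset P by apply: subset_trans (subsetDl _ _) sYP.
  have sN : N Y' \subset N Y :\: X.
    apply/subsetP => c /nbrsP[cC [y /setDP[yY ny] Gyc]].
    rewrite in_setD; apply/andP; split; last by apply/nbrsP; split=> //; exists y.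
    by apply: contra ny => cX; apply/nbrsP; split=> //; exists c; rewrite // Gsym.
  have := subset_leq_card sN; have := maxY _ sY'; rewrite /def.
  have := N_le Y'; have := N_le Y; have := cardsID X (N Y); rewrite (setIidPr sX).
  by have := cardsID (nbrs G Y X) Y; rewrite (setIidPr (nbrs_sub _ _ _)) -/Y'; lia.
exists ((P :\: Y) :|: h @: N Y); split.
- rewrite subUset subsetDl /=; apply/subsetP => _ /imsetP[c cN ->].
  by apply: (subsetP sYP); case: (hP c cN).
(* The union is [P], and comparing [def P] with [def Y] gives
   [#|P| - #|Y| + #|N Y| <= #|N P| <= #|C|]. *)
- have := maxY (Y :|: (P :\: Y)); rewrite subUset sYP subsetDl => /(_ isT).
  rewrite /def /N nbrsU.
  have := cardsU Y (P :\: Y).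
  rewrite (_ : Y :&: (P :\: Y) = set0); last first.
    by apply/setP => x; rewrite !inE; case: (x \in Y).
  rewrite cards0; have := cardsU (P :\: Y) (h @: N Y).
  rewrite (card_in_imset injh) -/(N _) -/(N _).
  have : (#|N Y :|: N (P :\: Y)| <= #|C|)%N.
    by apply: subset_leq_card; rewrite subUset !nbrs_sub.
  have := N_le Y; have : (#|N Y| <= #|N Y :|: N (P :\: Y)|)%N.
    by rewrite subset_leq_card // subsetUl.
  by lia.
move=> C1; set K := _ :|: _; set V := U :\: _ => sC1 cov1.
have inV x : x \in U -> (x \in P -> x \in K) -> x \in V.
  by move=> xU xK; rewrite !in_setD xU andbT; apply/negP => /andP[/negP nK /xK].
(* Replacing the vertices of [C1] in [Y] by [N Y] gives a cover of [U]. It is no larger than [C1],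
   since each element of [N Y] missing from [C1] has its match under [h] in [C1 :&: Y]. *)
have := minC ((C1 :\: Y) :|: N Y); rewrite subUset.
have sC1U : C1 :\: Y \subset U.
  by apply: subset_trans (subsetDl _ _) _; apply: subset_trans sC1 (subsetDl _ _).
rewrite sC1U (subset_trans (nbrs_sub _ _ _) sCU).
have cov : covers U (C1 :\: Y :|: N Y).
  move=> u w uU wU Guw; rewrite !in_setU !in_setD.
  case: (boolP (u \in Y)) => [uY|nuY].
    rewrite [w \in N Y](_ : _ = true) ?orbT //; apply/nbrsP.
    by split; [apply: indep Guw; rewrite // (subsetP sYP) | exists u].
  case: (boolP (w \in Y)) => [wY|nwY].
    rewrite [u \in N Y](_ : _ = true) ?orbT //; apply/nbrsP.
    by rewrite Gsym in Guw; split; [apply: indep Guw; rewrite // (subsetP sYP) | exists w].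
  have -> // : (u \in C1) || (w \in C1) -> (u \in C1) || (u \in N Y) || ((w \in C1) || (w \in N Y)).
    by case/orP=> ->; rewrite ?orbT.
  by apply: cov1 Guw; apply: inV => // xP; rewrite in_setU in_setD xP ?nuY ?nwY.
move=> /(_ isT cov) le.
have le2 : (#|N Y :\: C1| <= #|C1 :&: Y|)%N.
  have injh' : {in N Y :\: C1 &, injective h}.
    by move=> x y /setDP[xN _] /setDP[yN _]; apply: injh.
  rewrite -(card_in_imset injh'); apply: subset_leq_card.
  apply/subsetP => _ /imsetP[c /setDP[cN nc] ->].
  have [hY Gch] := hP c cN; rewrite in_setI hY andbT.
  have cC := subsetP (nbrs_sub _ _ _) c cN.
  have cU := subsetP sCU c cC.
  have hP' : h c \in P := subsetP sYP _ hY.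
  have /setDP[hU _] := subsetP sP _ hP'.
  have cV : c \in V.
    by apply: inV => // cP; have /setDP[_] := subsetP sP _ cP; rewrite cC.
  have hV : h c \in V by apply: inV => // _; rewrite in_setU imset_f ?orbT.
  by have := cov1 c (h c) cV hV Gch; rewrite (negbTE nc).
have eU : C1 :\: Y :|: N Y = (C1 :\: Y) :|: (N Y :\: (C1 :\: Y)).
  by apply/setP => x; rewrite !inE; case: (x \in C1); case: (x \in Y); rewrite /= ?orbT.
have sND : #|N Y :|: (C1 :\: Y)| = (#|C1 :\: Y| + #|N Y :\: C1|)%N.
  rewrite setUC -(cardsID C1); congr (_ + _)%N; apply: eq_card => x.
    rewrite !inE; case: (boolP (x \in C1)); rewrite ?andbT ?andbF //= => xC1.
    case: (boolP (x \in Y)) => //= xY; apply/negbTE/negP => xN.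
    have /setDP[_ /negP nC] := subsetP sP _ (subsetP sYP _ xY).
    by apply: nC; case/andP: xN.
  by rewrite !inE; case: (x \in C1) => //=; case: (x \in Y).
have := cardsID Y C1; rewrite setUC sND in le.
by lia.
Qed.

End VertexCovers.

(** * The query game *)

(* [lia] compares cardinals up to conversion, which unfolds the sets; it is
   much faster once they are generalized. *)
Ltac card_lia :=
  repeat match goal with
         | H : is_true (leq _ _) |- _ => revert H
         | H : @eq nat _ _ |- _ => revert H
         end;
  clear;
  repeat match goal with
         | |- context [card ?A] => generalize (card A); intro
         end;
  lia.

Section Cardinals.
Variable T : finType.
Implicit Types A B F Z : {set T}.

Lemma leq_cardU A B : (#|A :|: B| <= #|A| + #|B|)%N.
Proof. by rewrite cardsU leq_subr. Qed.

Lemma ltn_cardsC A B x : A \subset B -> x \notin A -> x \in B ->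
  (#|~: B| < #|~: A|)%N.
Proof.
move=> sAB nxA xB; apply: proper_card; rewrite properC.
by apply/properP; split; last by exists x.
Qed.

Lemma cardsU_disjoint A B : [disjoint A & B] -> #|A :|: B| = (#|A| + #|B|)%N.
Proof. by move=> dAB; rewrite cardsU disjoint_setI0 // cards0 subn0. Qed.

Lemma disjoint_setU A B F :
  [disjoint A :|: B & F] = [disjoint A & F] && [disjoint B & F].
Proof. by rewrite -!setI_eq0 setIUl setU_eq0. Qed.

Lemma cardsIU_disjoint F A B : [disjoint A & B] ->
  #|F :&: (A :|: B)| = (#|F :&: A| + #|F :&: B|)%N.
Proof.
move=> dAB; rewrite setIUr cardsU_disjoint //.
by apply: disjointWl (subsetIr _ _) (disjointWr (subsetIr _ _) dAB).
Qed.

(** Each [a] is charged to itself if it lies in [F] and to its partner otherwise; as the pairs are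
    disjoint, this is injective. *)
Lemma pair_charge F A (h : T -> T) :
  {in A &, injective h} -> [disjoint A & h @: A] ->
  (forall a, a \in A -> (a \in F) || (h a \in F)) ->
  (#|A| <= #|F :&: (A :|: h @: A)|)%N.
Proof.
move=> injh disj cov; pose g a := if a \in F then a else h a.
have hA a b : a \in A -> b \in A -> a <> h b.
  by move=> aA bA e; move: (disjointFr disj aA); rewrite e imset_f.
have injg : {in A &, injective g}.
  move=> a b aA bA; rewrite /g; case: ifP => _; case: ifP => _ //.
  - by move/(hA _ _ aA bA).
  - by move=> e; case: (hA b a bA aA).
  - exact: injh.
rewrite -(card_in_imset injg); apply/subset_leq_card/subsetP => _ /imsetP[a aA ->].
rewrite in_setI in_setU /g; have := cov a aA.
by case: (boolP (a \in F)) => [-> _|_ /= ->]; rewrite ?aA ?imset_f ?orbT.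
Qed.

End Cardinals.

Section Game.
Variables (R : Type) (T : finType) (box : (T -> R) -> Prop).
Variables (feas : {set T} -> (T -> R) -> Prop) (pr : T -> R).
Implicit Types (Q F A C X B W : {set T}) (v y : T -> R).

Definition agree Q v y := forall i, i \in Q -> v i = y i.
Definition possible Q v y := box y /\ agree Q v y.

Definition bounded Q y :=
  (forall F, feas F y -> (#|Q| <= 2 * #|F|)%N) /\
  ((forall i, pr i = y i) -> forall F, feas F y -> (2 * #|Q| <= 3 * #|F|)%N).

(* [Q] has been queried with the answers [v]; only the restriction of [v] to
   [Q] matters. *)
Inductive winning Q v : Prop :=
| winning_stop : feas Q v -> (forall y, possible Q v y -> bounded Q y) -> winning Q v
| winning_query i : i \notin Q ->
    (forall y, possible Q v y -> winning (i |: Q) y) -> winning Q v.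

Definition forced Q v i := forall y F, possible Q v y -> feas F y -> i \in F.
Definition saturated Q v := forall i, forced Q v i -> i \in Q.
Definition witness Q v i j :=
  [/\ i != j, i \notin Q, j \notin Q
    & forall y F, possible Q v y -> feas F y -> (i \in F) || (j \in F)].

Definition mandatory := [set i | `[< forall F, feas F pr -> i \in F >]].

Definition mandatory_pair Q :=
  exists d a, [/\ d \in mandatory, a \in mandatory & witness Q pr d a].

(** Under the predictions, [d], [a] and [a'] are three queries of which two are mandatory. If [d] or
    [a] refutes its prediction, they are still a witness pair; if both hold, [a'] becomes forced. *)
Definition mandatory_fork Q :=
  exists d a a', [/\ a \in mandatory, a' \in mandatory :\: Q, a != a', d \notin mandatory
   & witness Q pr d a /\
     forall Q', Q \subset Q' -> saturated Q' pr -> d \in Q' -> a' \in Q'].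

Section Residual.
Variables (Q : {set T}) (G : rel T).
Let U := ~: (Q :|: mandatory).

(** The situation for minima: edges are met by feasible sets whatever the values turn out to be, so
    a cover can be queried in any order. *)
Definition static_residual :=
  (forall y F, possible Q pr y -> feas F y -> covers G U F) /\
  (forall Q' y, possible Q pr y -> Q :|: mandatory \subset Q' -> saturated Q' y ->
     covers G U Q' -> feas Q' y).

(** The situation for spanning trees. [X] is the part of the cover [C] still to be queried, and [c]
    is the element to query next: its pairs with neighbours outside [C] are met by every feasible
    set once the mandatory elements and the rest of the cover have shown their predicted values. *)
Definition bipartite_residual :=
  exists side : pred T, (forall u w, G u w -> side u != side w) /\
  forall C X, C \subset U -> covers G U C -> X \subset C -> X != set0 ->
    exists2 c, c \in X & forall f, f \in U :\: C -> G c f ->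
      forall y F, possible (Q :|: mandatory :|: (C :\: X)) pr y -> feas F y ->
        (c \in F) || (f \in F).

Definition residual_graph :=
  [/\ symmetric G,
      forall F, feas F pr -> covers G U F,
      forall C, C \subset U -> covers G U C -> feas (Q :|: mandatory :|: C) pr
    & static_residual \/ bipartite_residual].
End Residual.

Definition terminal Q :=
  exists (d : T -> T) G, [/\ {in mandatory :\: Q &, injective d},
    forall a, a \in mandatory :\: Q -> [/\ d a \notin mandatory, witness Q pr a (d a)
      & forall Q', Q \subset Q' -> saturated Q' pr -> d a \in Q' -> a \in Q']
    & residual_graph Q G].

Hypothesis feas_agree : forall Q v y, box v -> possible Q v y -> feas Q v -> feas Q y.
Hypothesis box_pr : box pr.
Hypothesis witness_exists : forall Q v,
  box v -> saturated Q v -> ~ feas Q v -> exists i j, witness Q v i j.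
Hypothesis trichotomy : forall Q,
  saturated Q pr -> [\/ mandatory_pair Q, mandatory_fork Q | terminal Q].

Lemma agree_sub Q Q' v y : Q \subset Q' -> agree Q' v y -> agree Q v y.
Proof. by move=> sQ ag i /(subsetP sQ) /ag. Qed.

Lemma agree_trans Q v y z : agree Q v y -> agree Q y z -> agree Q v z.
Proof. by move=> vy yz i iQ; rewrite vy // yz. Qed.

Lemma agree_sym Q v y : agree Q v y -> agree Q y v.
Proof. by move=> vy i iQ; rewrite vy. Qed.

Lemma possible_refl Q v : box v -> possible Q v v.
Proof. by []. Qed.

Lemma possible_trans Q Q' v y z : Q \subset Q' ->
  possible Q v y -> possible Q' y z -> possible Q v z.
Proof.
by move=> sQ [_ vy] [bz yz]; split=> //; apply: agree_trans vy (agree_sub sQ yz).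
Qed.

Lemma possible_sub Q Q' v y : Q \subset Q' -> possible Q' v y -> possible Q v y.
Proof. by move=> sQ [by_ ag]; split=> //; apply: agree_sub ag. Qed.

Lemma winning_agree Q v y : box v -> possible Q v y -> winning Q v -> winning Q y.
Proof.
move=> bv [by_ ag] [fQ bnd|i niQ win].
  apply: winning_stop; first by apply: feas_agree fQ.
  by move=> z pz; apply: bnd; apply: possible_trans pz.
by apply: (winning_query niQ) => z pz; apply: win; apply: possible_trans pz.
Qed.

Lemma bounded_sub Q Q' y : Q \subset Q' -> bounded Q' y -> bounded Q y.
Proof.
move=> /subset_leq_card le [b2 b3]; split=> [F /b2|e F /(b3 e)]; lia.
Qed.

Lemma winning_bounded Q v : winning Q v -> box v -> bounded Q v.
Proof.
elim=> {Q v} [Q v _ bnd bv|Q v i _ _ IH bv]; first exact: bnd.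
by apply: bounded_sub (IH v _ bv); rewrite ?subsetUr.
Qed.

(** Allows a whole batch to be queried without looking at the intermediate answers. *)
Lemma query_set B Q v : box v ->
  (forall y, possible Q v y -> winning (Q :|: B) y) -> winning Q v.
Proof.
have [n] := ubnP #|B :\: Q|; elim: n => // n IHn in Q v *; rewrite ltnS => le bv win.
have [e|[i]] := set_0Vmem (B :\: Q).
  by have := win v (possible_refl _ bv); rewrite (setUidPl _) // -setD_eq0 e.
rewrite in_setD => /andP[niQ iB].
apply: (winning_query niQ) => y py; apply: IHn.
- have := cardsD1 i (B :\: Q); rewrite in_setD niQ iB.
  by rewrite setDDl [Q :|: [set i]]setUC; lia.
- by case: py.
move=> z pz; have -> : i |: Q :|: B = Q :|: B.
  have /setUidPr eB : [set i] \subset B by rewrite sub1set.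
  by rewrite [i |: Q]setUC -setUA eB.
by apply: win; apply: possible_trans pz => //; apply: subsetUr.
Qed.

Lemma saturated_mandatory Q : mandatory \subset Q -> saturated Q pr.
Proof.
move=> sM i fi; apply: (subsetP sM); rewrite inE; apply/asboolP => F.
exact: fi (possible_refl _ box_pr).
Qed.

Lemma not_saturated Q v : ~ saturated Q v -> exists2 i, forced Q v i & i \notin Q.
Proof.
move=> ns; apply: contrapT => nex; apply: ns => i fi; apply: contraT => niQ.
by case: nex; exists i.
Qed.

Lemma forced_mandatory Q i : forced Q pr i -> i \in mandatory.
Proof.
by move=> fi; rewrite inE; apply/asboolP => F; apply: fi (possible_refl _ box_pr).
Qed.

Lemma mandatoryP i F : i \in mandatory -> feas F pr -> i \in F.
Proof. by rewrite inE => /asboolP; apply. Qed.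

(** Only the queried part of [F] is counted, here and in [consistent_so_far], so that the bounds for
    disjoint batches of queries add up. *)
Definition robust_so_far Q v :=
  forall y F, possible Q v y -> feas F y -> (#|Q| <= 2 * #|F :&: Q|)%N.

Definition consistent_so_far Q :=
  forall F, feas F pr -> (2 * #|Q| <= 3 * #|F :&: Q|)%N.

Lemma robust_add Q v y B : robust_so_far Q v -> possible Q v y -> [disjoint Q & B] ->
  (forall z F, possible Q v z -> feas F z -> (#|B| <= 2 * #|F :&: B|)%N) ->
  robust_so_far (Q :|: B) y.
Proof.
move=> rob py dQB robB z F pz fz; rewrite cardsU_disjoint // cardsIU_disjoint //.
have pz' : possible Q v z by apply: possible_trans pz; rewrite ?subsetUl.
by have := rob z F pz' fz; have := robB z F pz' fz; lia.
Qed.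

Lemma disjoint_singleton i Q : i \notin Q -> [disjoint Q & [set i]].
Proof. by rewrite disjoint_sym disjoints1. Qed.

Lemma robust_add_forced Q v y i : robust_so_far Q v -> possible Q v y ->
  i \notin Q -> forced Q v i -> robust_so_far (i |: Q) y.
Proof.
move=> rob py niQ fi; rewrite setUC; apply: (robust_add rob) py _ _.
  exact: disjoint_singleton.
move=> z F pz fz; rewrite (setIidPr _) ?sub1set ?cards1 //.
exact: fi pz fz.
Qed.

Lemma robust_add_witness Q v y i j : robust_so_far Q v -> possible Q v y ->
  witness Q v i j -> robust_so_far (Q :|: [set i; j]) y.
Proof.
move=> rob py [nij niQ njQ wij]; apply: (robust_add rob) py _ _.
  rewrite disjoint_sym; apply/pred0P => x /=; rewrite !inE.
  by apply/negP => /andP[/orP[]/eqP-> xQ]; [rewrite xQ in niQ | rewrite xQ in njQ].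
move=> z F pz fz; rewrite cards2 nij.
have : (0 < #|F :&: [set i; j]|)%N.
  rewrite card_gt0; apply/set0Pn; have := wij z F pz fz.
  by case/orP => ?; [exists i | exists j]; rewrite !inE eqxx ?orbT andbT.
by lia.
Qed.

(* Once a prediction is refuted, only the factor 2 matters, and witness pairs
   achieve it. *)
Lemma winning_mispredicted Q v : box v -> robust_so_far Q v -> ~ agree Q pr v ->
  winning Q v.
Proof.
have [n] := ubnP #|~: Q|; elim: n => // n IHn in Q v *; rewrite ltnS => le bv rob mis.
case: (pselect (feas Q v)) => [fQ|nfQ].
  apply: winning_stop => // y py; split=> [F fF|e F].
    have := rob y F py fF; have := subset_leq_card (subsetIl F Q); lia.
  by case: mis => i iQ; rewrite e; case: py => _ ->.
have mis' Q' y : Q \subset Q' -> possible Q v y -> ~ agree Q' pr y.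
  move=> sQ py ag; apply: mis; apply: agree_trans (agree_sub sQ ag) _.
  by apply: agree_sym; case: py.
have leD B i : i \notin Q -> i \in B -> (#|~: (Q :|: B)| < n)%N.
  move=> niQ iB; apply: leq_trans le.
  by apply: (ltn_cardsC _ niQ); rewrite ?subsetUl // in_setU iB orbT.
case: (pselect (saturated Q v)) => [clQ|nclQ].
  have [i [j wij]] := witness_exists bv clQ nfQ.
  apply: (@query_set [set i; j]) => // y py; apply: IHn.
  - by case: wij => _ niQ _ _; apply: (leD _ i); rewrite ?inE ?eqxx.
  - by case: py.
  - exact: robust_add_witness wij.
  - by apply: (mis' _ _ _ py); apply: subsetUl.
have [i fi niQ] := not_saturated nclQ.
apply: (winning_query niQ) => y py; apply: IHn.
- by rewrite setUC; apply: (leD _ i); rewrite ?inE ?eqxx.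
- by case: py.
- exact: robust_add_forced fi.
- by apply: (mis' _ _ _ py); apply: subsetUr.
Qed.

(** Forced elements are queried one by one while the predictions hold. They are then mandatory, and
    they belong to every feasible set, so they cost nothing in either ratio. The premises are the
    two ways to end: a refuted prediction, or saturation. *)
Lemma close_predicted Q :
  (forall Q' y, Q \subset Q' -> Q' \subset Q :|: mandatory -> box y -> agree Q pr y ->
     (forall z F, possible Q' y z -> feas F z -> Q' :\: Q \subset F) ->
     ~ agree Q' pr y -> winning Q' y) ->
  (forall Q', Q \subset Q' -> Q' \subset Q :|: mandatory ->
     (forall z F, possible Q' pr z -> feas F z -> Q' :\: Q \subset F) ->
     saturated Q' pr -> winning Q' pr) ->
  winning Q pr.
Proof.
move=> hmis hcl.
suff H n Q' : (#|~: Q'| < n)%N -> Q \subset Q' -> Q' \subset Q :|: mandatory ->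
    (forall z F, possible Q' pr z -> feas F z -> Q' :\: Q \subset F) -> winning Q' pr.
  apply: (H _ Q (ltnSn _) (subxx _) (subsetUl _ _)) => z F _ _.
  by rewrite setDv sub0set.
elim: n Q' => // n IHn Q'; rewrite ltnS => le sQ sQM Ff.
case: (pselect (saturated Q' pr)) => [cl|ncl]; first exact: hcl.
have [i fi niQ] := not_saturated ncl.
have sQ1 : Q \subset i |: Q' by apply: subset_trans sQ (subsetUr _ _).
have sQM1 : i |: Q' \subset Q :|: mandatory.
  by rewrite subUset sQM sub1set in_setU (forced_mandatory fi) orbT.
have Ff1 z F : possible Q' pr z -> feas F z -> (i |: Q') :\: Q \subset F.
  move=> pz fz; rewrite setDUl subUset (Ff z) ?andbT //.
  by apply: subset_trans (subsetDl _ _) _; rewrite sub1set; apply: fi fz.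
apply: (winning_query niQ) => y py.
have [by_ agy] := py.
case: (pselect (agree (i |: Q') pr y)) => [ag|mis].
  apply: (@winning_agree _ pr) => //; apply: IHn => //.
    by apply: leq_trans le; apply: (ltn_cardsC _ niQ); rewrite ?subsetUr ?setU11.
  by move=> z F pz; apply: Ff1; apply: possible_sub pz; apply: subsetUr.
apply: hmis => //; first exact: agree_sub agy.
by move=> z F pz; apply: Ff1; apply: possible_trans pz => //; apply: subsetUr.
Qed.

(** The same closure whatever the answers are; the added elements need no longer be mandatory, but
    every feasible set contains them. *)
Lemma close_robust Q v : box v ->
  (forall Q' y, Q \subset Q' -> possible Q v y -> saturated Q' y ->
     (forall z F, possible Q' y z -> feas F z -> Q' :\: Q \subset F) -> winning Q' y) ->
  winning Q v.
Proof.
move=> bv hcl.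
suff H n Q' y : (#|~: Q'| < n)%N -> Q \subset Q' -> possible Q v y ->
    (forall z F, possible Q' y z -> feas F z -> Q' :\: Q \subset F) -> winning Q' y.
  apply: (H _ Q v (ltnSn _) (subxx _) (possible_refl _ bv)) => z F _ _.
  by rewrite setDv sub0set.
elim: n Q' y => // n IHn Q' y; rewrite ltnS => le sQ py Ff.
case: (pselect (saturated Q' y)) => [cl|ncl]; first exact: hcl.
have [i fi niQ] := not_saturated ncl.
apply: (winning_query niQ) => z pz; apply: IHn.
- by apply: leq_trans le; apply: (ltn_cardsC _ niQ); rewrite ?subsetUr ?setU11.
- by apply: subset_trans sQ (subsetUr _ _).
- by apply: possible_trans pz.
move=> x F px fx; have px' : possible Q' y x.
  by apply: possible_trans px => //; apply: subsetUr.
rewrite setDUl subUset (Ff x) // andbT.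
by apply: subset_trans (subsetDl _ _) _; rewrite sub1set; apply: fi fx.
Qed.

(** * The last phase: partners of mandatory elements and a minimum cover *)

Section Residual_phase.
Variables (Q : {set T}) (d : T -> T) (G : rel T).
Let S := mandatory :\: Q.
Let U := ~: (Q :|: mandatory).
Let P := d @: S.
Hypothesis d_inj : {in S &, injective d}.
Hypothesis dP : forall a, a \in S -> [/\ d a \notin mandatory, witness Q pr a (d a)
  & forall Q', Q \subset Q' -> saturated Q' pr -> d a \in Q' -> a \in Q'].
Hypothesis Gsym : symmetric G.
Hypothesis Gpr : forall F, feas F pr -> covers G U F.
Hypothesis Gfeas : forall C, C \subset U -> covers G U C ->
  feas (Q :|: mandatory :|: C) pr.
Hypothesis robQ : robust_so_far Q pr.
Hypothesis consQ : consistent_so_far Q.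

Lemma d_in_U a : a \in S -> d a \in U.
Proof. by case/dP => nM [_ _ nQ _] _; rewrite in_setC in_setU negb_or nQ. Qed.

Lemma P_sub_U : P \subset U.
Proof. by apply/subsetP => _ /imsetP[a aS ->]; apply: d_in_U. Qed.

Lemma inU x : x \in U -> (x \notin Q) * (x \notin mandatory) * (x \notin S).
Proof.
by rewrite in_setC in_setU negb_or in_setD => /andP[nQ nM]; rewrite nQ nM.
Qed.

Lemma disjoint_S_U A B : A \subset S -> B \subset U -> [disjoint A & B].
Proof.
move=> sA sB; apply/pred0P => x /=; apply/negP => /andP[/(subsetP sA) xS].
by move/(subsetP sB)/inU; rewrite xS => -[].
Qed.

Lemma disjoint_Q_SU B : B \subset S :|: U -> [disjoint Q & B].
Proof.
move=> sB; apply/pred0P => x /=; apply/negP => /andP[xQ /(subsetP sB)].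
by rewrite in_setU => /orP[/setDP[_]|/inU]; rewrite xQ // => -[[]].
Qed.

Lemma charge_pairs A z F : A \subset S -> possible Q pr z -> feas F z ->
  (#|A| <= #|F :&: (A :|: d @: A)|)%N.
Proof.
move=> sA pz fz; apply: pair_charge.
- by move=> a b /(subsetP sA) aS /(subsetP sA) bS; apply: d_inj.
- apply: disjoint_S_U => //; apply: subset_trans P_sub_U; exact: imsetS.
- by move=> a /(subsetP sA) /dP[_ [_ _ _ w] _]; apply: w fz.
Qed.

(** The pairs [{a, d a}] are disjoint witness pairs, so querying all of [S] and [P] respects the
    factor 2, which is all that matters after a refutation. *)
Lemma winning_complete_pairs Q' y : Q \subset Q' -> Q' \subset Q :|: (S :|: P) ->
  box y -> agree Q pr y -> ~ agree Q' pr y -> winning Q' y.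
Proof.
move=> sQ sQ' by_ ag mis; apply: (@query_set (S :|: P)) => // z pz.
have -> : Q' :|: (S :|: P) = Q :|: (S :|: P).
  apply/eqP; rewrite eqEsubset subUset sQ' subsetUr /=.
  by rewrite subUset (subset_trans sQ) ?subsetUl ?subsetUr.
apply: winning_mispredicted.
- by case: pz.
- apply: (robust_add robQ (v := pr)).
  + by apply: possible_trans pz.
  + by apply: disjoint_Q_SU; apply: setUS P_sub_U.
  + move=> x F px fx; have := charge_pairs (subxx S) px fx.
    by have := leq_cardU S P; have := leq_imset_card d S; rewrite -/P; card_lia.
- move=> agz; apply: mis; apply: agree_trans (agree_sub sQ' agz) _.
  by apply: agree_sym; case: pz.
Qed.

Section With_cover.
Variables (C0 K : {set T}).
Hypothesis minC0 : min_cover G U C0.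
Hypothesis K_sub : K \subset P :&: (U :\: C0).
Hypothesis K_le : (#|K| <= #|C0|)%N.

(** Elements of [S1] wait for their partners, which form [D]; those of [S2] are queried without
    their partners [P2], which stay available as witnesses. [Q3] is the position before the cover is
    queried. *)
Let S1 := [set a in S | d a \in C0 :|: K].
Let S2 := S :\: S1.
Let D := d @: S1.
Let P2 := d @: S2.
Let Q3 := Q :|: mandatory :|: D.

Let S1_sub : S1 \subset S. Proof. by apply/subsetP => a; rewrite inE => /andP[]. Qed.
Let S2_sub : S2 \subset S. Proof. exact: subsetDl. Qed.
Let D_sub : D \subset P. Proof. exact: imsetS. Qed.
Let P2_sub : P2 \subset P. Proof. exact: imsetS. Qed.
Let C0_sub : C0 \subset U. Proof. by case: minC0. Qed.
Let S_eq : S = S1 :|: S2.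
Proof. by rewrite setUC -[LHS](setID S S1) setUC (setIidPr S1_sub). Qed.
Let QM_eq : Q :|: mandatory = Q :|: S.
Proof. by apply/setP => x; rewrite !in_setU in_setD; case: (x \in Q). Qed.

Let D_eq : D = P :&: (C0 :|: K).
Proof.
apply/setP => x; rewrite in_setI; apply/imsetP/andP.
  by case=> a; rewrite inE => /andP[aS dC] ->; rewrite dC imset_f.
by case=> /imsetP[a aS ->] dC; exists a; rewrite // inE aS.
Qed.

Let P2_eq : P2 = (P :&: (U :\: C0)) :\: K.
Proof.
apply/setP => x; rewrite in_setD in_setI in_setD; apply/imsetP/and3P.
  case=> a /setDP[aS]; rewrite inE aS in_setU negb_or => /andP[nC nK] ->.
  by rewrite nC nK imset_f // d_in_U.
case=> nK /imsetP[a aS e] /andP[nC _]; exists a => //.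
by rewrite in_setD aS inE aS in_setU negb_or -e nC nK.
Qed.

(* The elements of [S1] pay for themselves and for their partners in [D],
   which are therefore missing here. *)
Let E_card F W : W \subset U :\: P2 ->
  (#|F :&: (Q :|: S1 :|: (S2 :|: P2) :|: W)| =
   #|F :&: Q| + #|F :&: S1| + #|F :&: (S2 :|: P2)| + #|F :&: W|)%N.
Proof.
move=> /subsetDP[sWU dW].
have sPU : P2 \subset U by apply: subset_trans P2_sub P_sub_U.
have dQ A : A \subset S :|: U -> [disjoint Q & A] := @disjoint_Q_SU A.
have sS1 : S1 \subset S :|: U by apply: subset_trans S1_sub (subsetUl _ _).
have sS2 : S2 :|: P2 \subset S :|: U by apply: setUSS.
have sW : W \subset S :|: U by apply: subset_trans sWU (subsetUr _ _).
have d1W : [disjoint S1 & W] by apply: disjoint_S_U.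
have d12 : [disjoint S1 & S2 :|: P2].
  rewrite disjoint_sym disjoint_setU [X in _ && X]disjoint_sym.
  by rewrite (disjoint_S_U (A := S1)) // andbT disjoints_subset subsetDr.
have d2W : [disjoint S2 :|: P2 & W].
  by rewrite disjoint_setU disjoint_S_U //= disjoint_sym.
rewrite (cardsIU_disjoint F (A := Q :|: S1 :|: (S2 :|: P2))); last first.
  by rewrite 2!disjoint_setU (dQ W) // d1W d2W.
rewrite (cardsIU_disjoint F (A := Q :|: S1)).
  by rewrite (cardsIU_disjoint F (A := Q)) // dQ.
by rewrite disjoint_setU dQ.
Qed.

Let S2_charge z F : possible Q pr z -> feas F z -> (#|S2| <= #|F :&: (S2 :|: P2)|)%N.
Proof. exact: (charge_pairs S2_sub). Qed.

Let D_card : (#|D| <= #|S1|)%N. Proof. exact: leq_imset_card. Qed.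
Let P2_card : (#|P2| <= #|S2|)%N. Proof. exact: leq_imset_card. Qed.
Let S_card : #|S| = (#|S1| + #|S2|)%N.
Proof. by rewrite S_eq cardsU_disjoint // disjoint_sym disjoints_subset subsetDr. Qed.

(** After [S2] and [D], the confirmed predictions on [D] make [S1] forced, so closing under forced
    elements ends exactly at [Q3] and leaves [S1] inside every feasible set. A refutation before
    that is answered by completing the pairs. *)
Lemma winning_after_pairs :
  ((forall z F, possible Q3 pr z -> feas F z -> S1 \subset F) -> winning Q3 pr) ->
  winning Q pr.
Proof.
move=> win3; apply: (@query_set (S2 :|: D)) => // y py.
set Q2 := Q :|: (S2 :|: D).
have sQ2 : Q2 \subset Q :|: (S :|: P) by apply: setUS; apply: setUSS.
have [by_ ag] := py.
case: (pselect (agree Q2 pr y)) => [ag2|mis]; last first.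
  by apply: winning_complete_pairs mis; rewrite ?subsetUl.
apply: (@winning_agree _ pr) => //; apply: close_predicted => [Q' z|Q'] sQ' sM.
  move=> bz agz _ mis; apply: winning_complete_pairs mis => //.
  - by apply: subset_trans sQ'; apply: subsetUl.
  - apply: subset_trans sM _; rewrite subUset sQ2.
    by apply: subset_trans (subsetUr Q _) _; rewrite QM_eq; apply: setUS; apply: subsetUl.
  - by apply: agree_sub agz; apply: subsetUl.
move=> Ff cl.
have sQ : Q \subset Q' by apply: subset_trans sQ'; apply: subsetUl.
have sS1 : S1 \subset Q'.
  apply/subsetP => a aS1; have aS := subsetP S1_sub a aS1.
  have [_ _ cause] := dP aS; apply: cause => //.
  by apply: (subsetP sQ'); rewrite !in_setU imset_f ?orbT.
have e3 : Q' = Q3.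
  apply/eqP; rewrite eqEsubset; apply/andP; split.
    apply: subset_trans sM _; apply/subsetP => x; rewrite !in_setU.
    case/orP=> [/or3P[->|/(subsetP S2_sub)/setDP[->]|->]|->]; by rewrite ?orbT.
  rewrite /Q3 QM_eq S_eq !subUset sQ sS1 /=.
  by rewrite -subUset; apply: subset_trans sQ'; apply: subsetUr.
rewrite e3; apply: win3 => z F; rewrite -e3 => pz fz; apply: subset_trans (Ff z F pz fz).
rewrite subsetD sS1 disjoint_sym /Q2 disjoint_setU disjoint_setU.
rewrite disjoint_Q_SU ?(subset_trans S1_sub) ?subsetUl //=.
rewrite disjoints_subset /S2 subsetDr /= disjoint_sym disjoint_S_U //.
exact: subset_trans D_sub P_sub_U.
Qed.

Let F_lower F W : S1 \subset F -> W \subset U :\: P2 ->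
  (#|F :&: Q| + #|S1| + #|F :&: (S2 :|: P2)| + #|F :&: W| =
   #|F :&: (Q :|: S1 :|: (S2 :|: P2) :|: W)|)%N.
Proof. by move=> sF sW; rewrite E_card // (setIidPr sF). Qed.

Let Q3_card A : (#|Q3 :|: A| <= #|Q| + #|S| + #|S1| + #|A|)%N.
Proof.
have := leq_cardU Q3 A; have := leq_cardU (Q :|: mandatory) D.
by rewrite -/Q3 QM_eq; have := leq_cardU Q S; card_lia.
Qed.

Let feas_pr y F : box y -> (forall i, pr i = y i) -> feas F y -> feas F pr.
Proof. by move=> by_ e; apply: feas_agree => //; split=> // i _; rewrite e. Qed.

(** [F] contains [S], and [F :&: U] is a cover, so it has at least [#|C0|] elements. The queries
    beyond [Q] lie in [S], [K] and [C0], and [2 * #|K| <= #|S| + #|C0|]. *)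
Let consistent_final F : feas F pr -> (2 * #|Q3 :|: C0| <= 3 * #|F|)%N.
Proof.
move=> fF; have cF := consQ fF.
have cov : covers G U (F :&: U).
  by move=> u w uU wU Guw; rewrite !in_setI uU wU !andbT; apply: (Gpr fF) Guw.
have leC : (#|C0| <= #|F :&: U|)%N by case: minC0 => _ _; apply; rewrite ?subsetIr.
have sSF : S \subset F.
  by apply/subsetP => a /setDP[aM _]; apply: mandatoryP aM fF.
have leF : (#|F :&: Q| + #|S| + #|F :&: U| <= #|F|)%N.
  have := subset_leq_card (subsetIl F (Q :|: S :|: U)).
  have dQS : [disjoint Q & S] by apply: disjoint_Q_SU; apply: subsetUl.
  have dQU : [disjoint Q & U] by apply: disjoint_Q_SU; apply: subsetUr.
  rewrite (cardsIU_disjoint F (A := Q :|: S)); last first.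
    by rewrite disjoint_setU dQU disjoint_S_U.
  by rewrite cardsIU_disjoint // (setIidPr sSF).
have leK : (#|K| <= #|S|)%N.
  apply: leq_trans (leq_imset_card d S); apply: subset_leq_card.
  by apply: subset_trans K_sub (subsetIl _ _).
have : Q3 :|: C0 \subset Q :|: S :|: (K :|: C0).
  rewrite /Q3 QM_eq -setUA; apply: setUS; rewrite subUset subsetUr andbT D_eq.
  by rewrite setUC; apply: subsetIr.
move/subset_leq_card; have := leq_cardU (Q :|: S) (K :|: C0).
by have := leq_cardU Q S; have := leq_cardU K C0; card_lia.
Qed.

Hypothesis S1_forced : forall z F, possible Q3 pr z -> feas F z -> S1 \subset F.

Let Q_sub3 : Q \subset Q3. Proof. by rewrite /Q3 -setUA subsetUl. Qed.
Let D_sub_U : D \subset U. Proof. exact: subset_trans D_sub P_sub_U. Qed.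

(** The cover is queried, then the elements [E] that became forced. With factor 2, each element of
    [F] can be charged twice: in [S1] for itself and for [D]; in [S2 :|: P2] for [S2] and for
    [E :&: P2]; in [U :\: P2] for [C0] and for the rest of [E]. *)
Lemma winning_static :
  (forall C1, C1 \subset U :\: (P :&: (U :\: C0) :\: K) ->
     covers G (U :\: (P :&: (U :\: C0) :\: K)) C1 -> (#|C0| <= #|C1|)%N) ->
  static_residual Q G -> winning Q3 pr.
Proof.
move=> ess [Gcov Gsolved]; apply: (@query_set C0) => // y py.
apply: close_robust => [|Q' z sQ' pz cl Ff]; first by case: py.
have py3 : possible Q3 pr z by apply: possible_trans pz; rewrite ?subsetUl.
have pyz : possible Q pr z by apply: possible_sub py3.
have sQ3' : Q3 \subset Q' by apply: subset_trans sQ'; apply: subsetUl.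
have sC0 : C0 \subset Q' by apply: subset_trans sQ'; apply: subsetUr.
apply: winning_stop => [|x px].
  apply: Gsolved => //; first by apply: subset_trans sQ3'; apply: subsetUl.
  move=> u w uU wU Guw; case: minC0 => _ cov _.
  by have := cov u w uU wU Guw; case/orP=> /(subsetP sC0) ->; rewrite ?orbT.
set E := Q' :\: (Q3 :|: C0) in Ff.
have cardQ' : #|Q'| = (#|Q3 :|: C0| + #|E|)%N.
  by rewrite -(cardsID (Q3 :|: C0) Q') (setIidPr sQ').
have px3 : possible Q3 pr x by apply: possible_trans px.
have pxQ : possible Q pr x by apply: possible_sub px3.
split=> [F fF|epr F fF]; last first.
  (* If all predictions are right, forced elements are mandatory, and these are already in [Q3]. *)
  have eE : E = set0.
    apply/eqP; rewrite -subset0; apply/subsetP => i iE.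
    suff iM : i \in mandatory.
      by case/setDP: iE => _; rewrite /Q3 !in_setU iM !orbT.
    rewrite inE; apply/asboolP => F' fF'.
    apply: (subsetP (Ff pr F' _ fF')) => //; split=> // j jQ.
    by case: px => _ ->.
  by rewrite cardQ' eE cards0 addn0; apply: consistent_final; apply: feas_pr epr fF; case: px3.
have sEF : E \subset F by apply: Ff fF.
have sEU : E \subset U.
  apply/subsetP => i /setDP[_]; rewrite in_setU negb_or => /andP[].
  by rewrite in_setU negb_or => /andP[]; rewrite in_setC.
have low := F_lower (S1_forced px3 fF) (subxx (U :\: P2)).
have := subset_leq_card (subsetIl F (Q :|: S1 :|: (S2 :|: P2) :|: (U :\: P2))).
(* By the choice of [K], deleting [P2] from the graph does not make covers smaller. *)
have leC : (#|C0| <= #|F :&: (U :\: P2)|)%N.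
  rewrite P2_eq; apply: ess; rewrite ?subsetIr // => u w uU wU Guw; rewrite !in_setI uU wU !andbT.
  by apply: (Gcov x F pxQ fF) Guw; [case/setDP: uU | case/setDP: wU].
have leE1 : (#|E :&: P2| <= #|F :&: (S2 :|: P2)|)%N.
  by apply: subset_leq_card; apply: setISS => //; apply: subsetUr.
have leE2 : (#|E :\: P2| <= #|F :&: (U :\: P2)|)%N.
  apply: subset_leq_card; rewrite subsetI setSD // andbT.
  by apply: subset_trans sEF; apply: subsetDl.
have := cardsID P2 E; have := Q3_card C0; have := S2_charge pxQ fF; have := robQ pxQ fF.
by have := S_card; card_lia.
Qed.

(** The cover is queried in the order given by [bipartite_residual]. By [paired], each queried [c]
    outside [D] has its match [h c] as a reserve: every feasible set still possible contains one of
    the two, so after a refutation the matches can be queried within the factor 2. *)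
Lemma winning_bipartite (h : T -> T) : {in C0 &, injective h} ->
  (forall c, c \in C0 -> h c \in U :\: C0 /\ G c (h c)) ->
  P :&: (h @: C0) \subset K -> bipartite_residual Q G -> winning Q3 pr.
Proof.
move=> injh hP hK [side [bip ord]].
have sC0Q3 A : A \subset C0 -> A \subset U by move=> sA; apply: subset_trans C0_sub.
pose known X := Q3 :|: (C0 :\: X).
pose paired X := forall z F, possible (known X) pr z -> feas F z ->
  forall c, c \in C0 :\: D :\: X -> (c \in F) || (h c \in F).
(* The matches stay out of [P2] because [K] contains all matched partners; hence the charges to the
   pairs [{c, h c}] and to [S2 :|: P2] do not overlap. *)
have sW A : A \subset C0 :\: D -> A :|: h @: A \subset U :\: P2.
  move=> sA; have sAC : A \subset C0 by apply: subset_trans sA (subsetDl _ _).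
  rewrite subsetD; apply/andP; split.
    rewrite subUset sC0Q3 //=; apply/subsetP => _ /imsetP[c cA ->].
    by case: (hP c (subsetP sAC c cA)) => /setDP[].
  rewrite disjoint_setU P2_eq; apply/andP; split; apply/pred0P => x /=; apply/negP.
    case/andP=> /(subsetP sAC) xC /setDP[/setIP[_ /setDP[_]]]; by rewrite xC.
  case/andP=> /imsetP[c cA ->] /setDP[/setIP[hPc _] /negP]; apply.
  by apply: (subsetP hK); rewrite in_setI hPc imset_f // (subsetP sAC).
have charge A z F : A \subset C0 :\: D -> possible Q3 pr z -> feas F z ->
    (forall c, c \in A -> (c \in F) || (h c \in F)) ->
    (#|F :&: Q| + #|S1| + #|S2| + #|A| <= #|F :&: (Q :|: S1 :|: (S2 :|: P2) :|: (A :|: h @: A))|)%N.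
  move=> sA pz fz cov; have sAC : A \subset C0 by apply: subset_trans sA (subsetDl _ _).
  have := F_lower (S1_forced pz fz) (sW A sA).
  have : (#|A| <= #|F :&: (A :|: h @: A)|)%N.
    apply: pair_charge => //.
      by move=> a b aA bA; apply: injh; apply: (subsetP sAC).
    apply/pred0P => x /=; apply/negP => /andP[/(subsetP sAC) xC /imsetP[c cA e]].
    by case: (hP c (subsetP sAC c cA)) => /setDP[_]; rewrite -e xC.
  by have := S2_charge (possible_sub Q_sub3 pz) fz; card_lia.
(* [X] is the part of the cover still to be queried, at first [C0 :\: D] because [D] is already in
   [Q3]. *)
suff step n X : (#|X| < n)%N -> X \subset C0 :\: D -> paired X -> winning (known X) pr.
  have e : known (C0 :\: D) = Q3.
    apply/setUidPl; apply/subsetP => x /setDP[xC]; rewrite in_setD xC andbT negbK => xD.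
    by rewrite /Q3 in_setU xD orbT.
  rewrite -e; apply: (step _ _ (ltnSn _)) => // z F _ _ c.
  by rewrite setDv in_set0.
elim: n X => // n IHn X; rewrite ltnS => leX sX pairX.
have sXC : X \subset C0 by apply: subset_trans sX (subsetDl _ _).
have [X0|/set0Pn Xn0] := eqVneq X set0.
  rewrite X0 /known setD0 in pairX *.
  apply: winning_stop => [|y py].
    rewrite /Q3 -setUA; apply: Gfeas; first by rewrite subUset D_sub_U.
    move=> u w uU wU Guw; case: minC0 => _ cov _.
    by have := cov u w uU wU Guw; rewrite !in_setU => /orP[] ->; rewrite ?orbT.
  have py3 : possible Q3 pr y by apply: possible_sub py; apply: subsetUl.
  split=> [F fF|epr F fF]; last first.
    by apply: consistent_final; apply: feas_pr epr fF; case: py3.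
  have := charge (C0 :\: D) y F (subxx _) py3 fF.
  have cov c : c \in C0 :\: D -> (c \in F) || (h c \in F).
    by move=> cC; apply: (pairX y F) => //; rewrite ?X0 ?setD0 /known ?setD0.
  move/(_ cov); set Z := _ :|: (_ :|: h @: _).
  have := subset_leq_card (subsetIl F Z).
  have := robQ (possible_sub Q_sub3 py3) fF.
  have -> : Q3 :|: C0 = Q3 :|: (C0 :\: D).
    by apply/setP => x; rewrite /Q3 !in_setU in_setD; case: (x \in D); rewrite ?orbT.
  by have := Q3_card (C0 :\: D); have := S_card; card_lia.
have [_ covC0 _] := minC0.
have [|c cX cP] := ord C0 X C0_sub covC0 sXC; first by apply/set0Pn.
have [cC ncD] := setDP (subsetP sX c cX).
have [hcU Gch] := hP c cC.
have ncQ : c \notin known X.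
  rewrite /known /Q3 !in_setU in_setD cX (negbTE ncD) !orbF -in_setU.
  by have := subsetP C0_sub c cC; rewrite in_setC.
have e1 : c |: known X = known (X :\ c).
  apply/setP => x; rewrite /known in_setU1 !in_setU !in_setD in_set1.
  by case: eqP => [->|]; rewrite ?cC ?orbT.
have pairXc z F : possible (known X) pr z -> feas F z ->
    forall c', c' \in C0 :\: D :\: (X :\ c) -> (c' \in F) || (h c' \in F).
  move=> pz fz c' c'C; case: (eqVneq c' c) => [->|ne]; last first.
    by apply: (pairX z F) => //; move: c'C; rewrite !in_setD !in_set1 ne.
  by apply: (cP (h c)) fz => //; apply: possible_sub pz; apply: setSU; apply: subsetUl.
have sXc : known X \subset known (X :\ c) by rewrite -e1 subsetUr.
apply: (winning_query ncQ) => y py; rewrite e1.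
have [by_ ag] := py.
case: (pselect (agree (known (X :\ c)) pr y)) => [agX|mis].
  apply: (@winning_agree _ pr) => //; apply: IHn => //.
  - by apply: leq_trans leX; rewrite [#|X|](cardsD1 c) cX.
  - by apply: subset_trans (subsetDl _ _) sX.
  - by move=> z F pz; apply: pairXc; apply: possible_sub pz.
(* The answer for [c] refutes its prediction. [C1] is the part of the cover outside [D] queried so
   far, [c] included; its matches and [P2] are now queried as well, which completes all pairs. *)
pose C1 := C0 :\: D :\: (X :\ c).
have sC1 : C1 \subset C0 :\: D by apply: subsetDl.
apply: (@query_set (P2 :|: h @: C1)) => // z pz.
have [bz agz] := pz.
apply: winning_mispredicted => // [x F px fx|agZ]; last first.
  apply: mis; apply: agree_trans (agree_sub (subsetUl _ _) agZ) _.
  exact: agree_sym.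
have pxX : possible (known X) pr x.
  by apply: (possible_trans (v := pr) (Q := known X)) px; 
    [apply: subset_trans sXc (subsetUl _ _) | apply: possible_trans pz].
have px3 : possible Q3 pr x by apply: possible_sub pxX; apply: subsetUl.
have := charge C1 x F sC1 px3 fx (pairXc x F pxX fx).
set E := Q :|: S1 :|: (S2 :|: P2) :|: (C1 :|: h @: C1); set Z := known _ :|: _.
have sEZ : E \subset Z.
  apply/subsetP => i; rewrite /E /Z /known /Q3 QM_eq S_eq /C1 !in_setU !in_setD.
  by do ![case: (_ \in _) => //=].
(* The queries in [D] are paid by [S1], which lies in every feasible set:
   [#|S1| + #|D| <= 2 * #|S1|]. *)
have sZE : Z \subset E :|: D.
  apply/subsetP => i; rewrite /E /Z /known /Q3 QM_eq S_eq /C1 !in_setU !in_setD.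
  by do ![case: (_ \in _) => //=].
have := subset_leq_card (setIS F sEZ); have := subset_leq_card sZE.
have := leq_cardU (Q :|: S1 :|: (S2 :|: P2)) (C1 :|: h @: C1); rewrite -/E.
have := leq_cardU E D.
have := leq_cardU (Q :|: S1) (S2 :|: P2); have := leq_cardU Q S1.
have := leq_cardU S2 P2; have := leq_cardU C1 (h @: C1); have := leq_imset_card h C1.
have := robQ (possible_sub Q_sub3 px3) fx.
by have := D_card; have := P2_card; card_lia.
Qed.

End With_cover.

(** In the static case [K] comes from [essential_part]; in the bipartite case it consists of the
    partners that are matches [h c] of cover vertices. *)
Lemma winning_residual :
  static_residual Q G \/ bipartite_residual Q G -> winning Q pr.
Proof.
have [C0 minC0] := min_cover_exists G U.
have [sC0 _ _] := minC0.
case=> [stat|bip].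
  have [||K [sK leK ess]] := essential_part (P := P :&: (U :\: C0)) _ minC0 => //.
    exact: subsetIr.
  apply: (@winning_after_pairs C0 K) => S1F.
  exact: (winning_static minC0 sK leK S1F ess stat).
have [side [bipG _]] := bip.
have [h [injh hP]] := bipartite_matching Gsym minC0 bipG.
have sK : P :&: h @: C0 \subset P :&: (U :\: C0).
  by apply: setIS; apply/subsetP => _ /imsetP[c cC ->]; case: (hP c cC).
apply: (@winning_after_pairs C0 (P :&: h @: C0)) => S1F.
apply: (winning_bipartite minC0 sK _ S1F injh hP (subxx _) bip).
by apply: leq_trans (leq_imset_card h C0); apply: subset_leq_card; apply: subsetIr.
Qed.

End Residual_phase.

Lemma witnessC Q v i j : witness Q v i j -> witness Q v j i.
Proof.
case=> ij iQ jQ w; split=> //; first by rewrite eq_sym.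
by move=> y F py kF; rewrite orbC; apply: w kF.
Qed.

Definition causes Q d a := witness Q pr a d /\
  forall Q', Q \subset Q' -> saturated Q' pr -> d \in Q' -> a \in Q'.

(** A cause inside [mandatory] would give a mandatory pair, and a common cause of two elements gives
    a fork. Otherwise any choice of causes is injective and avoids [mandatory]. *)
Lemma fork_or_terminal Q G : ~ mandatory_pair Q -> residual_graph Q G ->
  (forall a, a \in mandatory :\: Q -> exists d, causes Q d a) ->
  mandatory_fork Q \/ terminal Q.
Proof.
move=> nopair resG exd.
have cause_notin d a : a \in mandatory :\: Q -> causes Q d a -> d \notin mandatory.
  by case/setDP=> aM _ [w _]; apply/negP => dM; apply: nopair; exists a, d.
case: (pselect (exists d a a', [/\ a \in mandatory :\: Q, a' \in mandatory :\: Q,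
    a != a', causes Q d a & causes Q d a'])) => [|nofork].
  case=> d [a [a' [aS a'S ne ca [_ c']]]]; left; exists d, a, a'.
  split=> //; first by case/setDP: aS.
    exact: cause_notin ca.
  by split=> //; apply: witnessC; case: ca.
right; pose d a := if pselect (exists d, causes Q d a) is left ex then projT1 (cid ex) else a.
have dP a : a \in mandatory :\: Q -> causes Q (d a) a.
  by move/exd=> ex; rewrite /d; case: pselect => // ex'; case: (cid ex').
exists d, G; split=> // [a b aS bS e|a aS].
  apply/eqP; apply: contraT => ne; case: nofork; exists (d a), a, b; split=> //.
    exact: dP.
  by rewrite e; apply: dP.
by have ca := dP a aS; split; [apply: cause_notin ca | case: ca..].
Qed.

(** Induction on the number of unqueried elements. A forced element is queried alone; in a saturated
    position [trichotomy] gives either a batch that preserves both invariants or the last phase. *)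
Lemma winning_pr Q : robust_so_far Q pr -> consistent_so_far Q -> winning Q pr.
Proof.
have [n] := ubnP #|~: Q|; elim: n => // n IHn in Q *; rewrite ltnS => le rob cons.
case: (pselect (saturated Q pr)) => [cl|ncl]; last first.
  have [i fi niQ] := not_saturated ncl.
  apply: (winning_query niQ) => y py; have [by_ ag] := py.
  case: (pselect (agree (i |: Q) pr y)) => [agi|mis]; last first.
    by apply: winning_mispredicted mis; last exact: robust_add_forced fi.
  apply: (@winning_agree _ pr) => //; apply: IHn.
  - by apply: leq_trans le; apply: (ltn_cardsC _ niQ); rewrite ?subsetUr ?setU11.
  - exact: robust_add_forced (possible_refl _ box_pr) niQ fi.
  move=> F fF; rewrite setUC cardsU_disjoint ?disjoint_singleton //.
  rewrite cardsIU_disjoint ?disjoint_singleton //.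
  rewrite cards1 [X in (_ + #|pred_of_set X|)%N](setIidPr _) ?cards1 ?sub1set; last first.
    exact: mandatoryP (forced_mandatory fi) fF.
  by have := cons F fF; card_lia.
have pair_step d a : witness Q pr d a ->
    (agree (Q :|: [set d; a]) pr pr -> winning (Q :|: [set d; a]) pr) -> winning Q pr.
  move=> w win; apply: (@query_set [set d; a]) => // y py; have [by_ ag] := py.
  case: (pselect (agree (Q :|: [set d; a]) pr y)) => [aga|mis].
    by apply: (@winning_agree _ pr) => //; apply: win.
  by apply: winning_mispredicted mis; last exact: robust_add_witness w.
have disjQ d a : witness Q pr d a -> [disjoint Q & [set d; a]].
  case=> _ ndQ naQ _; rewrite disjoint_sym; apply/pred0P => x /=; rewrite !inE.
  by apply/negP => /andP[/orP[]/eqP-> xQ]; [rewrite xQ in ndQ | rewrite xQ in naQ].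
have ltC d a Q' : witness Q pr d a -> Q :|: [set d; a] \subset Q' -> (#|~: Q'| < n)%N.
  case=> _ ndQ _ _ sQ; apply: leq_trans le; apply: (ltn_cardsC _ ndQ).
    by apply: subset_trans sQ; apply: subsetUl.
  by apply: (subsetP sQ); rewrite !inE eqxx orbT.
case: (trichotomy cl) => [[d [a [dM aM w]]]|[d [a [a' [aM a'MQ ne ndM [w cause]]]]]|].
- apply: pair_step (w) _ => _; apply: IHn; first by apply: ltC w _.
    exact: robust_add_witness (possible_refl _ box_pr) w.
  move=> F fF; rewrite cardsU_disjoint ?(disjQ _ _ w) // cardsIU_disjoint ?(disjQ _ _ w) //.
  rewrite (setIidPr (_ : [set d; a] \subset F)); last first.
    by rewrite subUset !sub1set !(mandatoryP _ fF).
  by have := cons F fF; have := cards2 d a; case: (_ != _); card_lia.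
- have [a'M na'Q] := setDP a'MQ.
  have ne' : a' != d by apply: contraNneq ndM => <-.
  apply: pair_step (w) _ => _; apply: close_predicted =>
    [Q' y sQ sQM by_ ag Ff mis|Q' sQ sQM Ff cl'].
    apply: winning_mispredicted mis => // z F pz fz.
    have pz' : possible (Q :|: [set d; a]) pr z.
      by apply: possible_trans (pz); last split.
    have := robust_add_witness rob (possible_refl _ box_pr) w pz' fz.
    rewrite -(cardsID (Q :|: [set d; a]) Q') (setIidPr sQ).
    have <- := cardsID (Q :|: [set d; a]) (F :&: Q').
    rewrite -setIA (setIidPr sQ) -setIDA.
    by rewrite [X in (_ <= _ * (_ + #|pred_of_set X|))%N](setIidPr (Ff z F pz fz)); card_lia.
  have a'Q' : a' \in Q'.
    apply: cause => //; first by apply: subset_trans sQ; apply: subsetUl.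
    by apply: (subsetP sQ); rewrite !inE eqxx orbT.
  have cardQ' : #|Q'| = (#|Q| + 2 + #|Q' :\: (Q :|: [set d; a])|)%N.
    rewrite -[LHS](cardsID (Q :|: [set d; a]) Q') (setIidPr sQ).
    by rewrite cardsU_disjoint ?(disjQ _ _ w) // cards2; case: w => ->.
  have cardF F : Q' :\: (Q :|: [set d; a]) \subset F ->
      #|F :&: Q'| = (#|F :&: Q| + #|F :&: [set d; a]| + #|Q' :\: (Q :|: [set d; a])|)%N.
    move=> sF; rewrite -[LHS](cardsID (Q :|: [set d; a])) -setIA (setIidPr sQ).
    by rewrite cardsIU_disjoint ?(disjQ _ _ w) // -setIDA (setIidPr sF).
  apply: IHn; first exact: ltC w sQ.
    move=> z F pz fz; rewrite cardQ' cardF ?(Ff z) //.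
    have pz' : possible Q pr z.
      by apply: possible_sub pz; apply: subset_trans sQ; apply: subsetUl.
    have := rob z F pz' fz.
    have : (0 < #|F :&: [set d; a]|)%N.
      rewrite card_gt0; apply/set0Pn; case: w => _ _ _ /(_ z F pz' fz).
      by case/orP => ?; [exists d | exists a]; rewrite !inE eqxx ?orbT andbT.
    by card_lia.
  move=> F fF; rewrite cardQ' cardF ?(Ff pr) //.
  have : (0 < #|F :&: [set d; a]|)%N.
    by rewrite card_gt0; apply/set0Pn; exists a; rewrite !inE eqxx orbT (mandatoryP aM).
  (* The new queries are [d], [a] and [n] forced elements, of which [F] contains at least [1 + n];
     as [a'] is one of the latter, [n >= 1] and [2 * (2 + n) <= 3 * (1 + n)]. *)
  have : (0 < #|Q' :\: (Q :|: [set d; a])|)%N.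
    rewrite card_gt0; apply/set0Pn; exists a'; rewrite !inE a'Q' andbT.
    by rewrite (negbTE na'Q) (negbTE ne') eq_sym (negbTE ne).
  by have := cons F fF; card_lia.
case=> d [G [dinj dP [Gsym Gpr Gfeas res]]].
exact: (winning_residual dinj dP Gsym Gpr Gfeas rob cons res).
Qed.

Theorem winning_start : winning set0 pr.
Proof.
by apply: winning_pr => [y F _ _|F _]; rewrite setI0 cards0.
Qed.

End Game.

(** * From winning positions to algorithms *)

Section Algorithms.
Local Open Scope ring_scope.
Variables (R : realType) (pb : problem R).

Definition admissible (T : finType) (k : known R T) (x : T -> R) :=
  forall i, x i \in itv_of k i.

Definition solved (T : finType) (P : input pb T) (k : known R T)
    (Q : {set T}) (v : T -> R) :=
  exists a : answer P, forall x, admissible k x ->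
    (forall i, i \in Q -> x i = v i) -> correct x a.

Lemma solved_possible (T : finType) (P : input pb T) (k : known R T) Q v y :
  admissible k v -> possible (admissible k) Q v y ->
  solved P k Q v -> solved P k Q y.
Proof.
move=> _ [_ ag] [a aP]; exists a => x bx ex; apply: aP => // i iQ.
by rewrite ex // ag.
Qed.

Hypothesis win : forall (T : finType) (P : input pb T) (k : known R T),
  winning (admissible k) (solved P k) (predicted k) set0 (predicted k).
Hypothesis solvedT : forall (T : finType) (P : input pb T) (k : known R T) x,
  admissible k x -> solved P k setT x.

Let asked (T : finType) (h : seq (T * R)) : {set T} := [set i in unzip1 h].

Let outcome (T : finType) (k : known R T) (h : seq (T * R)) : T -> R :=
  fun i => nth (predicted k i) (unzip2 h) (index i (unzip1 h)).

(** A strategy sees the history and not the true values, hence the quantification over all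
    assignments compatible with the history. *)
Let good_query (T : finType) (P : input pb T) (k : known R T) (h : seq (T * R)) i :=
  i \notin asked h /\
  forall y, possible (admissible k) (asked h) (outcome k h) y ->
    winning (admissible k) (solved P k) (predicted k) (i |: asked h) y.

(** The query is chosen classically from those that keep every compatible position winning; from a
    winning position one of the first two branches always applies. *)
Let follow : strategy pb := fun T P k h =>
  if pselect (solved P k (asked h) (outcome k h)) then None
  else match pselect (exists i, good_query P k h i) with
       | left ex => Some (projT1 (cid ex))
       | right _ => [pick i | i \notin asked h]
       end.

Section Run.
Variable I : instance pb.
Let k := knw I.
Let P := inp I.
Let w : elt I -> R := @value R pb I.

Let truthful (h : seq (elt I * R)) := forall p, p \in h -> p.2 = w p.1.

Lemma outcomeE h i : truthful h -> i \in asked h -> outcome k h i = w i.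
Proof.
move=> hw; rewrite inE /outcome; elim: h hw => [|p h IHh] hw //=.
rewrite in_cons; case: eqP => [->|ne] /=; first by rewrite eqxx hw ?mem_head.
by move/IHh; rewrite eq_sym; case: eqP ne => // _ _; apply=> q qh;
  apply: hw; rewrite in_cons qh orbT.
Qed.

Lemma possible_outcome h : truthful h -> possible (admissible k) (asked h) (outcome k h) w.
Proof. by move=> hw; split=> [i|i iQ]; [apply: valueP | rewrite outcomeE]. Qed.

Lemma solved_outcome h : truthful h ->
  solved P k (asked h) (outcome k h) <-> feasible (asked h).
Proof.
move=> hw; split; last first.
  by case=> a aP; exists a => x bx ex; apply: aP => // i iQ; rewrite ex // outcomeE.
by case=> a aP; exists a => x bx ex; apply: aP => // i iQ; rewrite ex // outcomeE.
Qed.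

Let state_ok (h : seq (elt I * R)) := [/\ truthful h, uniq (unzip1 h)
  & winning (admissible k) (solved P k) (predicted k) (asked h) w].

Lemma follow_spec h : state_ok h ->
  match follow P k h with
  | None => feasible (asked h)
  | Some i => ~ feasible (asked h) /\ state_ok (rcons h (i, w i))
  end.
Proof.
case=> hw uh winh; rewrite /follow.
case: pselect => [/solved_outcome|nsol] /=; first exact.
have nfeas : ~ feasible (asked h) by move/(solved_outcome hw).
have bw : admissible k w by move=> i; apply: valueP.
have ex : exists i, good_query P k h i.
  case: winh => [[a aP] _|i niQ wini]; first by case: nfeas; exists a.
  exists i; split=> // y [by_ ag]; apply: wini; split=> // j jQ.
  by rewrite -ag // outcomeE.
case: pselect => [ex'|//] /=; case: (cid ex') => i [niQ wini] /=; split=> //.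
have eQ : asked (rcons h (i, w i)) = i |: asked h.
  by apply/setP => j; rewrite in_setU1 !inE /unzip1 map_rcons mem_rcons in_cons.
split.
- by move=> p; rewrite mem_rcons in_cons => /orP[/eqP-> //|/hw].
- by rewrite /unzip1 map_rcons rcons_uniq uh andbT; move: niQ; rewrite inE.
- by rewrite eQ; apply: wini; apply: possible_outcome.
Qed.

Lemma history_ok n : state_ok (history follow I n).
Proof.
elim: n => [|n IHn] /=.
  split=> //; have -> : asked (T := elt I) [::] = set0 by apply/setP => i; rewrite !inE.
  apply: (@winning_agree _ _ _ _ _ _ set0 (predicted k)) => //.
  - exact: solved_possible.
  - by move=> i; apply: predictedP.
  - by split=> [i|i]; [apply: valueP | rewrite inE].
by have := follow_spec IHn; rewrite /next_query -/k -/P; case: (follow _ _ _) => // i [].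
Qed.

Lemma follow_stops n :
  next_query follow (history follow I n) = None <-> feasible (queried (history follow I n)).
Proof.
have := follow_spec (history_ok n); rewrite /next_query -/k -/P.
by case: (follow _ _ _) => [i [nf _]|]; split.
Qed.

Lemma size_history n : (forall m, (m < n)%N -> next_query follow (history follow I m) <> None) ->
  size (history follow I n) = n.
Proof.
elim: n => // n IHn ne /=; have := ne n (ltnSn n).
case: (next_query _ _) => // i _; rewrite size_rcons IHn // => m /ltnW; exact: ne.
Qed.

Lemma card_queried n : #|asked (history follow I n)| = size (history follow I n).
Proof.
have [_ uh _] := history_ok n; rewrite -(size_map fst) -(card_uniqP uh).
by apply: eq_card => i; rewrite inE.
Qed.

(** No element is queried twice, so there are at most [#|elt I|] queries. *)
Lemma follow_halts : exists n, next_query follow (history follow I n) == None.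
Proof.
apply: contrapT => nh; pose n := #|elt I|.+1.
have := card_queried n; rewrite size_history => [e|m _ e]; last by apply: nh; exists m; apply/eqP.
by have := max_card (mem (asked (history follow I n))); rewrite e ltnn.
Qed.

(** The default value of the minimum is the size of [setT], which is feasible. *)
Lemma opt_attained : exists2 F : {set elt I}, feasible F & opt I = #|F|.
Proof.
rewrite /opt; apply: (big_ind (fun n => exists2 F, feasible F & n = #|F|)).
- exists setT; last by rewrite cardsT.
  by apply: solvedT => i; apply: valueP.
- move=> m n [F fF ->] [F' fF' ->].
  by case: (leqP #|F| #|F'|) => _; [exists F | exists F'].
- by move=> F /asboolP fF; exists F.
Qed.

End Run.

Lemma algorithm_of_winning : exists A : algorithm pb, consistent (3 / 2) A /\ robust 2 A.
Proof.
pose A := Algorithm follow_stops follow_halts; exists A.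
have bnd I : bounded (solved (inp I) (knw I)) (predicted (knw I))
    (asked (history follow I (num_queries A I))) (@value R pb I)
    /\ #|asked (history follow I (num_queries A I))| = num_queries A I.
  split.
    have [hw _ winh] := history_ok I (num_queries A I).
    by apply: winning_bounded winh _ => i; apply: valueP.
  rewrite card_queried size_history // => m; rewrite /num_queries.
  by case: ex_minnP => n _ minn ltmn e; have := minn m; rewrite e leqNgt ltmn => /(_ isT).
split=> I; have [[b2 b3] en] := bnd I; have [F fF eF] := opt_attained I.
  move=> correct_pr; have := b3 correct_pr F fF; rewrite en -eF.
  by rewrite -(ler_nat R) !natrM; lra.
by have := b2 F fF; rewrite en -eF -(ler_nat R) natrM.
Qed.

End Algorithms.

(** * Bases of a matroid with uncertain weights *)

Section Bases.
Local Open Scope ring_scope.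
Variables (R : realType) (T : finType) (bas : {set T} -> Prop).
Implicit Types (A B F Q : {set T}) (e f g h : T) (x y z : T -> R).

Definition exch A e f := [/\ e \in A, f \notin A & bas (f |: A :\ e)].

Definition symmetric_exchange := forall A B e, bas A -> bas B -> e \in A -> e \notin B ->
  exists f, exch A e f /\ exch B f e.

Lemma exch_neq A e f : exch A e f -> e != f.
Proof. by case=> eA fA _; apply: contraNneq fA => <-. Qed.

(* By [symmetric_exchange], being optimal is a local property. *)
Definition locally_optimal A x := forall e f, exch A e f -> x e <= x f.

Hypothesis SE : symmetric_exchange.
Hypothesis bas_exists : exists A, bas A.

Lemma exch_swap A e f h : exch A e f -> h \in A -> h != e ->
  e |: (f |: A :\ e) :\ h = f |: A :\ h.
Proof.
move=> ex hA he; have := exch_neq ex; case: ex => eA fA _ ef.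
have hf : h != f by apply: contraNneq fA => <-.
apply/setP => i; rewrite !inE; case: (eqVneq i e) => [->|ie] /=.
  by rewrite eA [e == h]eq_sym he orbT.
by case: (eqVneq i f) => [->|] //=; rewrite eq_sym hf.
Qed.

Lemma exch_swapr A e f g : exch A e f -> g \notin A -> g != f ->
  g |: (f |: A :\ e) :\ f = g |: A :\ e.
Proof.
move=> ex gA gf; have [_ fA _] := ex; apply/setP => i; rewrite !inE.
by case: (eqVneq i f) => [->|] //=; rewrite (negbTE fA) andbF.
Qed.

(** Minimizes the sum of [rank], the number of elements preferred to a given one. A general [r]
    instead of a comparison of weights leaves room for breaking ties. *)
Lemma preferred_basis (r : rel T) : transitive r -> irreflexive r ->
  exists2 A, bas A & forall e f, exch A e f -> ~~ r f e.
Proof.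
move=> tr ir; pose rank e := #|[pred g | r g e]|.
have rank_lt e f : r f e -> (rank f < rank e)%N.
  move=> rfe; apply: proper_card; apply/properP; split.
    by apply/subsetP => g; rewrite !inE => rgf; apply: tr rfe.
  by exists f; rewrite !inE ?rfe ?ir.
have [A0 bA0] := bas_exists.
pose P A := `[< bas A >]; have PA0 : P A0 by apply/asboolP.
case: (@arg_minnP _ A0 P (fun A => \sum_(e in A) rank e)%N PA0) => A /asboolP bA minA.
exists A => // e f ex; apply/negP => /rank_lt; have := exch_neq ex; case: ex => eA fA bA'.
move=> ef lt; have := minA (f |: A :\ e); rewrite /P => /(_ (asboolT bA')).
rewrite big_setU1 ?inE ?negb_and ?fA ?orbT //= (big_setD1 e eA) /=; lia.
Qed.

Lemma optimal_basis x : exists2 A, bas A & locally_optimal A x.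
Proof.
have [||A bA optA] := @preferred_basis (fun f e => x f < x e).
- by move=> f e g; apply: lt_trans.
- by move=> e; apply: ltxx.
by exists A => // e f /optA; rewrite -leNgt.
Qed.

(** Induction on [#|A :\: B|]: symmetric exchange of an [e] in [A :\: B] with some [f] shows
    [x e <= x f] by local optimality, and turns [B] into a basis closer to [A] and no heavier. *)
Lemma locally_optimalP A x : bas A ->
  locally_optimal A x <-> forall B, bas B -> \sum_(e in A) x e <= \sum_(e in B) x e.
Proof.
move=> bA; split=> [optA B|minA e f ex]; last first.
  have ef := exch_neq ex; have [eA fA bA'] := ex.
  have := minA _ bA'; rewrite big_setU1 ?inE ?negb_and ?fA ?orbT //=.
  by rewrite (big_setD1 e eA) /= lerD2r.
have [n] := ubnP #|A :\: B|; elim: n => // n IHn in B *; rewrite ltnS => le bB.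
have [AB|[e /setDP[eA eB]]] := set_0Vmem (A :\: B).
  have sAB : A \subset B by rewrite -setD_eq0 AB.
  have [BA|[f /setDP[fB fA]]] := set_0Vmem (B :\: A); last first.
    by have [e [[_ eB _] [eA _ _]]] := SE bB bA fB fA; rewrite (subsetP sAB e eA) in eB.
  by rewrite (_ : A = B) //; apply/eqP; rewrite eqEsubset sAB -setD_eq0 BA eqxx.
have [f [exA exB]] := SE bA bB eA eB; have ef := exch_neq exA.
have [[_ fA _] [fB _ bB']] := (exA, exB).
have lt : (#|A :\: (e |: B :\ f)| < n)%N.
  apply: leq_trans le; apply: proper_card; apply/properP; split.
    apply/subsetP => i; rewrite !inE negb_or negb_and negbK => /andP[/andP[ie]].
    by case: (eqVneq i f) => [->|_ /= -> ->] //; rewrite (negbTE fA).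
  by exists e; rewrite !inE ?eA ?eB ?eqxx.
apply: le_trans (IHn _ lt bB') _.
rewrite big_setU1 ?inE ?negb_and ?eB ?orbT //= [X in _ <= X](big_setD1 f fB) /=.
by rewrite lerD2r optA.
Qed.

Variables (lo hi : T -> R).

(* An uncertainty interval is [{lo e}] if [lo e = hi e], and is open otherwise. *)
Definition in_ival e (t : R) := if lo e < hi e then lo e < t < hi e else t == lo e.
Definition in_box x := forall e, in_ival e (x e).

Definition basis_known F y := exists A, bas A /\
  forall z, in_box z -> (forall e, e \in F -> z e = y e) -> locally_optimal A z.

Definition upd x e (t : R) : T -> R := fun i => if i == e then t else x i.

Lemma upd_same x e t : upd x e t e = t. Proof. by rewrite /upd eqxx. Qed.
Lemma upd_other x e t i : i != e -> upd x e t i = x i.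
Proof. by rewrite /upd => /negbTE ->. Qed.

Lemma upd_box x e t : in_box x -> in_ival e t -> in_box (upd x e t).
Proof. by move=> bx it i; rewrite /upd; case: eqP => [->|]. Qed.

Lemma upd_agree F x e t : e \notin F -> forall i, i \in F -> upd x e t i = x i.
Proof. by move=> eF i iF; apply: upd_other; apply: contraNneq eF => <-. Qed.

Lemma itv_lt_hi e t : lo e < hi e -> in_ival e t -> (lo e < t) * (t < hi e).
Proof. by rewrite /in_ival => -> /andP[-> ->]. Qed.

Lemma pick_below e c : lo e < hi e -> lo e < c -> exists2 t, in_ival e t & t < c.
Proof.
move=> lh lc; exists ((lo e + Num.min c (hi e)) / 2); rewrite /in_ival ?lh.
  by case: (leP c (hi e)) => ?; apply/andP; split; lra.
by case: (leP c (hi e)) => ?; lra.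
Qed.

Lemma pick_above e c : lo e < hi e -> c < hi e -> exists2 t, in_ival e t & c < t.
Proof.
move=> lh lc; exists ((hi e + Num.max c (lo e)) / 2); rewrite /in_ival ?lh.
  by case: (leP c (lo e)) => ?; apply/andP; split; lra.
by case: (leP c (lo e)) => ?; lra.
Qed.

Lemma basis_knownT x : in_box x -> basis_known setT x.
Proof.
move=> bx; have [A bA optA] := optimal_basis x; exists A; split=> // z bz ez e f /optA.
by rewrite !ez ?inE.
Qed.

(** The [g] with [exch A e g] form the fundamental cut of [e], the [h] with [exch A h f] the
    fundamental circuit of [f]. If [e] were unqueried, a basis avoiding it fails for values of [e]
    near [lo e], below some element of the cut, and a basis using it fails near [hi e], above some
    element of the circuit. *)
Lemma exch_forced A e f y F : bas A -> exch A e f -> lo e < hi e -> in_box y ->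
  (forall g, exch A e g -> lo e < y g) ->
  (forall h, exch A h f -> h != e -> y h < hi e) -> y f < hi e ->
  basis_known F y -> e \in F.
Proof.
move=> bA exA lh by_ cut circ yf [B [bB optB]]; apply: contraT => eF.
have opt t : in_ival e t -> locally_optimal B (upd y e t).
  by move=> it; apply: optB; [apply: upd_box | apply: upd_agree].
have [eA fA bA'] := exA; have ef := exch_neq exA.
case: (boolP (e \in B)) => eB; last first.
  have [g [exg exBg]] := SE bA bB eA eB.
  have [t it tg] := pick_below lh (cut g exg).
  have := opt t it g e exBg; rewrite upd_same upd_other; last by rewrite eq_sym (exch_neq exg).
  by rewrite leNgt tg.
have eA' : e \notin f |: A :\ e by rewrite !inE eqxx orbF.
have [h [exBh exA'h]] := SE bB bA' eB eA'; have eh := exch_neq exBh.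
have yh : y h < hi e.
  case: (eqVneq h f) => [-> //|hf]; apply: circ; rewrite 1?eq_sym //.
  have [hA' _ bA''] := exA'h.
  have hA : h \in A by move: hA'; rewrite !inE (negbTE hf) => /andP[].
  by split=> //; rewrite -(exch_swap exA hA) // eq_sym.
have [t it th] := pick_above lh yh.
have := opt t it e h exBh; rewrite upd_same upd_other; last by rewrite eq_sym.
by rewrite leNgt th.
Qed.

(** With [e] and [f] both unqueried, the cut puts [e] into the known basis [B] and the circuit keeps
    [f] out. Exchanging [e] between [B] and [f |: A :\ e] yields an [h]; it is not [f], whose
    interval reaches below [hi e], so it lies on the circuit and must be above every possible value
    of [e]. *)
Lemma exch_uncovered A e f y F : bas A -> exch A e f -> lo e < hi e -> lo f < hi f ->
  lo f < hi e -> in_box y ->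
  (forall g, exch A e g -> lo e < y g) -> (forall h, exch A h f -> y h < hi f) ->
  basis_known F y -> e \notin F -> f \notin F ->
  exists2 h, exch A h f & hi e <= y h.
Proof.
move=> bA exA lhe lhf lfe by_ cut circ [B [bB optB]] eF fF.
have [eA fA bA'] := exA; have ef := exch_neq exA.
have opt s t : in_ival e s -> in_ival f t -> locally_optimal B (upd (upd y e s) f t).
  move=> it is_; apply: optB; first by do !apply: upd_box.
  by move=> i iF; rewrite !(upd_agree _ _ _ iF).
have valE s t : upd (upd y e s) f t e = s by rewrite upd_other // upd_same.
have valO s t i : i != e -> i != f -> upd (upd y e s) f t i = y i.
  by move=> ie if_; rewrite !upd_other.
have eB : e \in B.
  apply: contraT => eB; have [g [exg exBg]] := SE bA bB eA eB.
  have [s is_ sg] := pick_below lhe (cut g exg).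
  have := opt s (y f) is_ (by_ f) g e exBg; rewrite valE.
  suff -> : upd (upd y e s) f (y f) g = y g by rewrite leNgt sg.
  case: (eqVneq g f) => [->|gf]; first by rewrite upd_same.
  by rewrite valO // eq_sym (exch_neq exg).
have fB : f \notin B.
  apply/negP => fB; have [h [exBh exh]] := SE bB bA fB fA.
  have [t it th] := pick_above lhf (circ h exh).
  have := opt (y e) t (by_ e) it f h exBh; rewrite upd_same valO ?(exch_neq exh) //.
    by rewrite leNgt th.
  by case: exBh => _ hB _; apply: contraNneq hB => ->.
have eA' : e \notin f |: A :\ e by rewrite !inE eqxx orbF.
have [h [exBh exA'h]] := SE bB bA' eB eA'; have eh := exch_neq exBh.
case: (eqVneq h f) => [hf|hf].
  have [t it tlt] := pick_below lhf lfe.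
  have [s is_ slt] := pick_above lhe tlt.
  by have := opt s t is_ it e h exBh; rewrite valE hf upd_same leNgt slt.
have [hA' _ bA''] := exA'h.
have hA : h \in A by move: hA'; rewrite !inE (negbTE hf) => /andP[].
have exh : exch A h f by split=> //; rewrite -(exch_swap exA hA) // eq_sym.
exists h => //; rewrite leNgt; apply/negP => lt.
have [s is_ slt] := pick_above lhe lt.
have := opt s (y f) is_ (by_ f) e h exBh; rewrite valE valO // 1?eq_sym //.
by rewrite leNgt slt.
Qed.

(** A basis [B] optimal for [x] contains [a] or it would violate the cut. It stays optimal when the
    value of [a] varies: an [f] that can replace [a] in [B] is on the cut of [a] in [A], or is at
    least as large as such an element. *)
Lemma known_without A a x : bas A -> a \in A -> lo a < hi a -> in_box x ->
  (forall f, exch A a f -> hi a <= x f) -> basis_known (~: [set a]) x.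
Proof.
move=> bA aA lh bx cut; have [B bB optB] := optimal_basis x.
have xa := itv_lt_hi lh (bx a).
exists B; split=> // z bz ez e f exB.
have eqz i : i != a -> z i = x i by move=> ia; apply: ez; rewrite !inE.
have aB : a \in B.
  apply: contraT => aB; have [g [exg exBg]] := SE bA bB aA aB.
  by have := le_trans (cut g exg) (optB g a exBg); rewrite leNgt xa.
have fa : f != a by case: exB => _ fB _; apply: contraNneq fB => ->.
rewrite (eqz f fa); case: (eqVneq e a) => [ea|ea]; last by rewrite (eqz e ea) optB.
rewrite {e}ea in exB *; have za := itv_lt_hi lh (bz a).
apply: le_trans (ltW za.2) _.
have [_ fB bB'] := exB.
have aB' : a \notin f |: B :\ a by rewrite !inE eqxx orbF eq_sym.
have [g [exg exB'g]] := SE bA bB' aA aB'.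
case: (eqVneq g f) => [<-|gf]; first exact: cut.
have [gB' _ bB''] := exB'g.
have gB : g \in B by move: gB'; rewrite !inE (negbTE gf) => /andP[].
apply: le_trans (cut g exg) (optB g f _); split=> //.
by rewrite -(exch_swap exB gB) // eq_sym (exch_neq exg).
Qed.

(** If [f] is unqueried, it is outside the known basis [B]; exchanging it between [f |: A :\ h] and
    [B] gives an element [g] that must be at most [lo f], and that can replace [h] in [A]. *)
Lemma exch_escape A h f x F : bas A -> exch A h f -> lo f < hi f -> in_box x ->
  (forall h', exch A h' f -> x h' < hi f) -> basis_known F x -> f \notin F ->
  lo f < x h -> exists2 g, exch A h g & x g <= lo f.
Proof.
move=> bA exA lh bx circ [B [bB optB]] fF lfh.
have opt t : in_ival f t -> locally_optimal B (upd x f t).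
  by move=> it; apply: optB; [apply: upd_box | apply: upd_agree].
have [hA fA bA'] := exA; have hf := exch_neq exA.
have fB : f \notin B.
  apply/negP => fB; have [h' [exBh exh]] := SE bB bA fB fA.
  have [t it th] := pick_above lh (circ h' exh).
  have := opt t it f h' exBh; rewrite upd_same upd_other ?(exch_neq exh) //.
  by rewrite leNgt th.
have fA' : f \in f |: A :\ h by rewrite !inE eqxx.
have [g [exA'g exBg]] := SE bA' bB fA' fB.
have [_ gA' bA''] := exA'g.
have gf : g != f by rewrite eq_sym (exch_neq exA'g).
have xg : x g <= lo f.
  rewrite leNgt; apply/negP => lt; have [t it tg] := pick_below lh lt.
  have := opt t it g f exBg; rewrite upd_same upd_other //.
  by rewrite leNgt tg.
have gh : g != h by apply: contraTneq xg => ->; rewrite -ltNge.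
have gA : g \notin A by move: gA'; rewrite !inE (negbTE gf) gh.
by exists g => //; split=> //; rewrite -(exch_swapr exA gA gf).
Qed.

End Bases.

(** * Dual matroids *)

Section Duality.
Local Open Scope ring_scope.
Variables (R : realType) (T : finType) (bas : {set T} -> Prop) (lo hi : T -> R).
Hypothesis SE : symmetric_exchange bas.
Hypothesis bas_exists : exists A, bas A.
Hypothesis lo_hi : forall e, lo e <= hi e.
Implicit Types (A B F Q : {set T}) (e f g h : T) (x y z : T -> R).

(** Complementing bases and negating weights preserves optimality, and exchanging [e] for [f]
    becomes exchanging [f] for [e]. Cuts and circuits, lower and upper limits thus trade places,
    which yields the dual forms of the exchange lemmas. *)
Definition dual A := bas (~: A).
Definition dlo e := - hi e.
Definition dhi e := - lo e.

Let dexch A e f : exch dual (~: A) f e = exch bas A e f.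
Proof.
have eqd : f \notin A -> e \in A -> ~: (e |: ~: A :\ f) = f |: A :\ e.
  move=> fA eA; apply/setP => i; rewrite !inE negb_or negb_and !negbK.
  case: (eqVneq i f) => [->|_] /=; last by [].
  by rewrite andbT; apply: contraNneq fA => ->.
apply/propext; rewrite /exch /dual !in_setC negbK; split=> -[fA eA]; first by rewrite eqd.
by rewrite eqd.
Qed.

Let dSE : symmetric_exchange dual.
Proof.
move=> A B e bA bB eA eB.
have eB' : e \in ~: B by rewrite in_setC.
have eA' : e \notin ~: A by rewrite in_setC negbK.
have [f [ex1 ex2]] := SE bB bA eB' eA'; exists f.
by split; [rewrite -[A]setCK | rewrite -[B]setCK]; rewrite dexch.
Qed.

Let din_ival e t : in_ival dlo dhi e (- t) = in_ival lo hi e t.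
Proof.
rewrite /in_ival ltrN2; case: ifP => [_|/negbT]; first by rewrite !ltrN2 andbC.
by rewrite -leNgt eqr_opp => le; congr (_ == _); apply/eqP; rewrite eq_le le lo_hi.
Qed.

Let dbox x : in_box lo hi x -> in_box dlo dhi (fun i => - x i).
Proof. by move=> bx e; rewrite din_ival. Qed.

Let dbox' x : in_box dlo dhi x -> in_box lo hi (fun i => - x i).
Proof. by move=> bx e; rewrite -din_ival opprK. Qed.

Let dknown F y : basis_known dual dlo dhi F (fun i => - y i) = basis_known bas lo hi F y.
Proof.
apply/propext; split=> -[A [bA optA]]; exists (~: A); split=> //.
- move=> z bz ez e f ex.
  have := optA (fun i => - z i) (dbox bz) _ f e; rewrite lerN2; apply.
    by move=> i /ez ->.
  by rewrite -[A]setCK dexch.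
- by rewrite /dual setCK.
- move=> z bz ez e f; rewrite dexch => ex.
  have := optA (fun i => - z i) (dbox' bz) _ f e ex; rewrite lerN2; apply.
  by move=> i /ez ->; rewrite opprK.
Qed.

Lemma exch_forced_dual A e f y F : bas A -> exch bas A e f -> lo f < hi f ->
  in_box lo hi y -> (forall h, exch bas A h f -> y h < hi f) ->
  (forall g, exch bas A e g -> g != f -> lo f < y g) -> lo f < y e ->
  basis_known bas lo hi F y -> f \in F.
Proof.
move=> bA ex lh by_ circ cut ye kF.
apply: (@exch_forced R T dual dSE dlo dhi (~: A) f e (fun i => - y i)); rewrite /dlo /dhi.
- by rewrite /dual setCK.
- by rewrite dexch.
- by rewrite ltrN2.
- exact: dbox.
- by move=> h; rewrite dexch ltrN2; apply: circ.
- by move=> g; rewrite dexch ltrN2; apply: cut.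
- by rewrite ltrN2.
- by rewrite dknown.
Qed.

Lemma exch_uncovered_dual A e f y F : bas A -> exch bas A e f -> lo e < hi e ->
  lo f < hi f -> lo f < hi e -> in_box lo hi y ->
  (forall g, exch bas A e g -> lo e < y g) -> (forall h, exch bas A h f -> y h < hi f) ->
  basis_known bas lo hi F y -> e \notin F -> f \notin F ->
  exists2 g, exch bas A e g & y g <= lo f.
Proof.
move=> bA ex lhe lhf lfe by_ cut circ kF eF fF.
have [g exg yg] : exists2 g, exch dual (~: A) g e & dhi f <= - y g.
  apply: (@exch_uncovered R T dual dSE dlo dhi (~: A) f e (fun i => - y i) F);
    rewrite /dlo /dhi ?ltrN2 //.
  - by rewrite /dual setCK.
  - by rewrite dexch.
  - exact: dbox.
  - by move=> h; rewrite dexch ltrN2; apply: circ.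
  - by move=> g; rewrite dexch ltrN2; apply: cut.
  - by rewrite dknown.
by exists g; [rewrite -dexch | rewrite -lerN2].
Qed.

Lemma known_without_dual A a x : bas A -> a \notin A -> lo a < hi a -> in_box lo hi x ->
  (forall e, exch bas A e a -> x e <= lo a) -> basis_known bas lo hi (~: [set a]) x.
Proof.
move=> bA aA lh bx circ; rewrite -dknown.
apply: (@known_without R T dual dSE _ dlo dhi (~: A)) => //; rewrite ?inE //.
- by have [B bB] := bas_exists; exists (~: B); rewrite /dual setCK.
- by rewrite /dual setCK.
- by rewrite ltrN2.
- exact: dbox.
- by move=> e; rewrite dexch lerN2; apply: circ.
Qed.

Lemma exch_escape_dual A e f x F : bas A -> exch bas A e f -> lo e < hi e ->
  in_box lo hi x -> (forall g, exch bas A e g -> lo e < x g) ->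
  basis_known bas lo hi F x -> e \notin F -> x f < hi e ->
  exists2 h, exch bas A h f & hi e <= x h.
Proof.
move=> bA ex lh bx cut kF eF lt.
have [h exh xh] : exists2 h, exch dual (~: A) f h & - x h <= dlo e.
  apply: (@exch_escape R T dual dSE dlo dhi (~: A) f e (fun i => - x i) F);
    rewrite /dlo /dhi ?ltrN2 //.
  - by rewrite /dual setCK.
  - by rewrite dexch.
  - exact: dbox.
  - by move=> g; rewrite dexch ltrN2; apply: cut.
  - by rewrite dknown.
by exists h; [rewrite -dexch | rewrite -lerN2].
Qed.

End Duality.

(** * Settled bases and overlapping exchanges after some queries *)

Section State.
Local Open Scope ring_scope.
Variables (R : realType) (T : finType) (bas : {set T} -> Prop) (lo hi : T -> R).
Hypothesis SE : symmetric_exchange bas.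
Hypothesis bas_exists : exists A, bas A.
Hypothesis lo_hi : forall e, lo e <= hi e.
Implicit Types (A B F Q : {set T}) (e f g h : T) (v x y z : T -> R).

Notation box := (in_box lo hi).
Notation feas := (basis_known bas lo hi).

Definition unknown Q e := (e \notin Q) && (lo e < hi e).
Definition cur_lo Q v e := if e \in Q then v e else lo e.
Definition cur_hi Q v e := if e \in Q then v e else hi e.

Lemma unknownE Q v e : unknown Q e ->
  [/\ e \notin Q, lo e < hi e, cur_lo Q v e = lo e & cur_hi Q v e = hi e].
Proof. by rewrite /cur_lo /cur_hi => /andP[eQ ->]; rewrite (negbTE eQ). Qed.

Lemma unknown_range Q v y e : unknown Q e -> possible box Q v y -> (lo e < y e) * (y e < hi e).
Proof. by case/andP=> _ lh [/(_ e) ye _]; apply: itv_lt_hi ye. Qed.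

Lemma cur_range Q v y e : possible box Q v y -> (cur_lo Q v e <= y e) * (y e <= cur_hi Q v e).
Proof.
rewrite /cur_lo /cur_hi => -[/(_ e) ye ag]; case: ifPn => [/ag -> //|eQ].
move: ye; rewrite /in_ival; case: ifP => [_ /andP[/ltW-> /ltW->] //|_ /eqP->].
by split=> //; apply: lo_hi.
Qed.

Lemma determined Q v y e : ~~ unknown Q e -> possible box Q v y ->
  (cur_lo Q v e = y e) * (cur_hi Q v e = y e).
Proof.
rewrite /unknown negb_and negbK /cur_lo /cur_hi => + [/(_ e) ye ag].
case: ifPn => [/ag -> //|_ /= /negbTE lh].
move: ye; rewrite /in_ival lh => /eqP->; split=> //; apply/eqP.
by rewrite eq_le lo_hi leNgt lh.
Qed.

Lemma feas_agree Q v y : box v -> possible box Q v y -> feas Q v -> feas Q y.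
Proof.
move=> _ [_ ag] [A [bA optA]]; exists A; split=> // z bz ez; apply: optA => // i iQ.
by rewrite ez // ag.
Qed.

Lemma feas_sub Q Q' y : Q \subset Q' -> feas Q y -> feas Q' y.
Proof.
move=> sQ [A [bA optA]]; exists A; split=> // z bz ez; apply: optA => // i iQ.
by rewrite ez // (subsetP sQ).
Qed.

(* A basis that is optimal both for the lower and for the upper limits. *)
Definition settled Q v A := bas A /\ forall e f, exch bas A e f ->
  [/\ cur_lo Q v e <= cur_lo Q v f, cur_hi Q v e <= cur_hi Q v f,
      unknown Q e -> forall y, possible box Q v y -> lo e < y f
    & unknown Q f -> forall y, possible box Q v y -> y e < hi f].

(** A basis is chosen by lower limits. If its upper limits are out of order at an exchange, an
    element of the circuit with the largest upper limit is forced, against saturation. *)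
Lemma settled_exists Q v : box v -> saturated box feas Q v -> exists A, settled Q v A.
Proof.
move=> bv cl; have pv : possible box Q v v by [].
(* Ties are broken in favour of determined elements; this makes [lo e < y f] strict for unknown
   [e]. *)
pose r f e := (cur_lo Q v f < cur_lo Q v e)
  || [&& cur_lo Q v f == cur_lo Q v e, ~~ unknown Q f & unknown Q e].
have [||A bA Ar] := @preferred_basis _ bas bas_exists r.
- move=> f e g /orP[lt1|/and3P[/eqP e1 u1 _]] /orP[lt2|/and3P[/eqP e2 u2 u3]];
    rewrite /r.
  + by rewrite (lt_trans lt1 lt2).
  + by rewrite -e2 lt1.
  + by rewrite e1 lt2.
  + by rewrite e1 e2 eqxx u1 u3 orbT.
- by move=> e; rewrite /r ltxx eqxx /= andNb.
have low e f : exch bas A e f -> cur_lo Q v e <= cur_lo Q v f.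
  by move/Ar; rewrite /r negb_or -leNgt => /andP[].
have cut e f y : exch bas A e f -> unknown Q e -> possible box Q v y -> lo e < y f.
  move=> ex ue py; have [_ _ le _] := unknownE v ue.
  rewrite -le; case: (boolP (unknown Q f)) => uf.
    have [_ _ lf _] := unknownE v uf.
    by apply: le_lt_trans (low _ _ ex) _; rewrite lf (unknown_range uf py).
  rewrite -(determined uf py).1 lt_neqAle (low _ _ ex) andbT.
  by have := Ar e f ex; rewrite /r negb_or ue uf !andbT eq_sym => /andP[].
have upp e f : exch bas A e f -> cur_hi Q v e <= cur_hi Q v f.
  move=> ex0; rewrite leNgt; apply/negP => lt0.
  pose H h := `[< exch bas A h f >] && (cur_hi Q v f < cur_hi Q v h).
  have He : H e by rewrite /H lt0 andbT; apply/asboolP.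
  have [m /andP[/asboolP exm ltm] maxm] := @arg_maxP _ _ _ e H (cur_hi Q v) He.
  have um h : exch bas A h f -> cur_hi Q v f < cur_hi Q v h -> unknown Q h.
    move=> exh lth; apply: contraT => uh; have := low _ _ exh.
    rewrite (determined uh pv).1 -(determined uh pv).2 leNgt.
    by rewrite (le_lt_trans _ lth) // (le_trans (cur_range f pv).1) // (cur_range f pv).2.
  have umm := um m exm ltm; have [mQ lhm _ hm] := unknownE v umm.
  have fm : forced box feas Q v m.
    move=> y F py; apply: (exch_forced SE bA exm lhm).
    - by case: py.
    - by move=> g exg; apply: cut exg umm py.
    - move=> h exh _; rewrite -hm; case: (ltP (cur_hi Q v f) (cur_hi Q v h)) => lth.
        have uh := um h exh lth; apply: lt_le_trans (maxm h _); last first.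
          by rewrite /H lth andbT; apply/asboolP.
        by have [_ _ _ ->] := unknownE v uh; rewrite (unknown_range uh py).
      by apply: le_lt_trans (cur_range h py).2 (le_lt_trans lth ltm).
    - by rewrite -hm; apply: le_lt_trans (cur_range f py).2 ltm.
  by have := cl m fm; rewrite (negbTE mQ).
exists A; split=> // e f ex; split; [exact: low | exact: upp | |].
  by move=> ue y; apply: cut.
move=> uf y py; have [_ _ lf hf] := unknownE v uf.
case: (boolP (unknown Q e)) => ue.
  have [_ _ _ he] := unknownE v ue; rewrite -hf.
  by apply: lt_le_trans (upp _ _ ex); rewrite he (unknown_range ue py).
rewrite -(determined ue py).1; apply: le_lt_trans (low _ _ ex) _.
by rewrite lf; case/andP: uf.
Qed.

Section Settled.
Variables (Q : {set T}) (v : T -> R) (A : {set T}).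
Hypothesis bv : box v.
Hypothesis stA : settled Q v A.
Let bA : bas A. Proof. by case: stA. Qed.
Let pv : possible box Q v v. Proof. by []. Qed.

Definition overlap e f := exch bas A e f /\ cur_lo Q v f < cur_hi Q v e.

Lemma overlap_unknown e f : overlap e f ->
  [/\ unknown Q e, unknown Q f & lo f < hi e].
Proof.
case=> ex lt; have [le he _ _] := stA.2 e f ex.
have ue : unknown Q e.
  apply: contraT => ue; move: lt; rewrite (determined ue pv).2 -(determined ue pv).1.
  by rewrite ltNge le.
have uf : unknown Q f.
  apply: contraT => uf; move: lt; rewrite (determined uf pv).1 -(determined uf pv).2.
  by rewrite ltNge he.
split=> //; move: lt; have [_ _ _ ->] := unknownE v ue.
by have [_ _ -> _] := unknownE v uf.
Qed.

Lemma overlapI e f y y' : exch bas A e f -> possible box Q v y -> possible box Q v y' ->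
  y f < y' e -> overlap e f.
Proof.
move=> ex py py' lt; split=> //; apply: le_lt_trans (cur_range f py).1 _.
exact: lt_le_trans lt (cur_range e py').2.
Qed.

Lemma settled_known F : Q \subset F ->
  (forall z, box z -> (forall i, i \in F -> z i = v i) ->
     forall e f, overlap e f -> z e <= z f) -> feas F v.
Proof.
move=> sQ H; exists A; split=> // z bz ez e f ex.
have pz : possible box Q v z by split=> // i /(subsetP sQ)/ez.
rewrite leNgt; apply/negP => lt; have := H z bz ez e f (overlapI ex pz pz lt).
by rewrite leNgt lt.
Qed.

Lemma overlap_uncovered e f y F : overlap e f -> possible box Q v y -> feas F y ->
  e \notin F -> f \notin F -> exists2 h, overlap h f & hi e <= y h.
Proof.
move=> ov py kF eF fF; have [ue uf lfe] := overlap_unknown ov; have [ex _] := ov.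
have [_ lhe _ _] := unknownE v ue; have [_ lhf lf _] := unknownE v uf.
have [h exh yh] : exists2 h, exch bas A h f & hi e <= y h.
  apply: (@exch_uncovered R T bas SE lo hi A e f y F) => //; first by case: py.
    by move=> g /stA.2[_ _ /(_ ue) cut _]; apply: cut.
  by move=> h /stA.2[_ _ _ /(_ uf) circ]; apply: circ.
exists h => //; split=> //; rewrite lf; apply: lt_le_trans lfe _.
exact: le_trans yh (cur_range h py).2.
Qed.

Lemma overlap_uncovered_dual e f y F : overlap e f -> possible box Q v y -> feas F y ->
  e \notin F -> f \notin F -> exists2 g, overlap e g & y g <= lo f.
Proof.
move=> ov py kF eF fF; have [ue uf lfe] := overlap_unknown ov; have [ex _] := ov.
have [_ lhe _ he] := unknownE v ue; have [_ lhf _ _] := unknownE v uf.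
have [g exg yg] : exists2 g, exch bas A e g & y g <= lo f.
  apply: (@exch_uncovered_dual R T bas lo hi SE lo_hi A e f y F) => //; first by case: py.
    by move=> g /stA.2[_ _ /(_ ue) cut _]; apply: cut.
  by move=> h /stA.2[_ _ _ /(_ uf) circ]; apply: circ.
exists g => //; split=> //; rewrite he; apply: le_lt_trans lfe.
exact: le_trans (cur_range g py).1 yg.
Qed.

Lemma overlap_top e f : overlap e f -> exists2 m, overlap m f &
  forall h, overlap h f -> hi h <= hi m.
Proof.
move=> ov; pose H h := `[< overlap h f >]; have He : H e by apply/asboolP.
have [m /asboolP ovm maxm] := @arg_maxP _ _ _ e H hi He.
by exists m => // h ovh; apply: maxm; apply/asboolP.
Qed.

Lemma overlap_bottom e f : overlap e f -> exists2 m, overlap e m &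
  forall g, overlap e g -> lo m <= lo g.
Proof.
move=> ov; pose H h := `[< overlap e h >]; have He : H f by apply/asboolP.
have [m /asboolP ovm minm] := @arg_minP _ _ _ f H lo He.
by exists m => // h ovh; apply: minm; apply/asboolP.
Qed.

(** A feasible set without [e] and [f] would require an [h] overlapping [f] whose value reaches
    [hi e], and hence its own upper limit, which is excluded as its interval is open. *)
Lemma witness_top e f : overlap e f -> (forall h, overlap h f -> hi h <= hi e) ->
  witness box feas Q v e f.
Proof.
move=> ov top; have [/andP[eQ _] /andP[fQ _] _] := overlap_unknown ov.
have [ex _] := ov; split=> //; first exact: exch_neq ex.
move=> y F py kF; apply: contraT; rewrite negb_or => /andP[eF fF].
have [h ovh yh] := overlap_uncovered ov py kF eF fF.
have [uh _ _] := overlap_unknown ovh.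
by have := le_trans (top h ovh) yh; rewrite leNgt (unknown_range uh py).
Qed.

Lemma witness_bottom e f : overlap e f -> (forall g, overlap e g -> lo f <= lo g) ->
  witness box feas Q v e f.
Proof.
move=> ov bot; have [/andP[eQ _] /andP[fQ _] _] := overlap_unknown ov.
have [ex _] := ov; split=> //; first exact: exch_neq ex.
move=> y F py kF; apply: contraT; rewrite negb_or => /andP[eF fF].
have [g ovg yg] := overlap_uncovered_dual ov py kF eF fF.
have [_ ug _] := overlap_unknown ovg.
by have := le_trans yg (bot g ovg); rewrite leNgt (unknown_range ug py).
Qed.

End Settled.

Lemma basis_witness Q v : box v -> saturated box feas Q v -> ~ feas Q v ->
  exists e f, witness box feas Q v e f.
Proof.
move=> bv cl nf; have [A stA] := settled_exists bv cl.
have [e [f ov]] : exists e f, overlap Q v A e f.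
  apply: contrapT => nov; apply: nf; apply: (settled_known stA) => // z _ _ e f ov.
  by case: nov; exists e, f.
have [m ovm top] := overlap_top ov.
by exists m, f; apply: (witness_top bv stA ovm).
Qed.

End State.

(** * Pairs, forks and the terminal position for one matroid *)

Section OneMatroid.
Local Open Scope ring_scope.
Variables (R : realType) (T : finType) (bas : {set T} -> Prop) (lo hi pr : T -> R).
Hypothesis SE : symmetric_exchange bas.
Hypothesis bas_exists : exists A, bas A.
Hypothesis lo_hi : forall e, lo e <= hi e.
Notation box := (in_box lo hi).
Notation feas := (basis_known bas lo hi).
Hypothesis box_pr : box pr.
Implicit Types (A B F Q C X : {set T}) (e f g h t a c : T) (v x y z : T -> R).

Notation mand := (mandatory feas pr).

Lemma mandatory_unknown Q a : a \in mand -> a \notin Q -> unknown lo hi Q a.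
Proof.
move=> aM aQ; rewrite /unknown aQ /= lt_neqAle lo_hi andbT; apply/eqP => e.
have := @mandatoryP _ _ feas pr a (~: [set a]) aM; rewrite !inE eqxx.
suff kn : feas (~: [set a]) pr by move=> /(_ kn).
have [A [bA optA]] := basis_knownT bas_exists box_pr.
exists A; split=> // z bz ez; apply: optA => // i _.
case: (eqVneq i a) => [->|ia]; last by apply: ez; rewrite !inE.
by move: (bz a) (box_pr a); rewrite /in_ival e ltxx => /eqP-> /eqP->.
Qed.

Section Residual_of_settled.
Variables (Q A : {set T}).
Hypothesis stA : settled bas lo hi Q pr A.
Hypothesis no_pair : ~ mandatory_pair box feas pr Q.
Let bA : bas A. Proof. by case: stA. Qed.
Let pp : possible box Q pr pr. Proof. by []. Qed.
Notation ov := (overlap bas lo hi Q pr A).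
Notation wit := (witness box feas Q pr).

(* The prediction for [t] lies in the interval of [a]. *)
Let hits_up t a := ov a t /\ pr t < hi a.
Let hits_down t a := ov t a /\ lo a < pr t.

(** The head with the largest upper limit exceeds the other predictions on the circuit of [t]; so it
    is mandatory by [exch_forced], and a witness partner of [t] by [witness_top]. *)
Let good_up t a : hits_up t a -> exists2 h, hits_up t h & h \in mand /\ wit h t.
Proof.
case=> ova lta; have [h ovh top] := overlap_top ova.
have [uh ut _] := overlap_unknown lo_hi box_pr stA ovh; have [exh _] := ovh.
have [_ lh _ _] := unknownE pr uh.
have lth : pr t < hi h := lt_le_trans lta (top _ ova).
exists h => //; split; last exact: (witness_top SE lo_hi box_pr stA ovh top).
rewrite inE; apply/asboolP => F.
apply: (exch_forced SE bA exh lh box_pr) => // [g /stA.2[_ _ /(_ uh) cut _]|h' exh' _].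
  exact: cut.
rewrite ltNge; apply/negP => le.
have ov' : ov h' t by apply: (overlapI lo_hi exh' pp pp); apply: lt_le_trans lth le.
have [uh' _ _] := overlap_unknown lo_hi box_pr stA ov'.
by have := le_trans (top _ ov') le; rewrite leNgt (unknown_range uh' pp).
Qed.

Let good_down t a : hits_down t a -> exists2 h, hits_down t h & h \in mand /\ wit t h.
Proof.
case=> ova lta; have [h ovh bot] := overlap_bottom ova.
have [ut uh _] := overlap_unknown lo_hi box_pr stA ovh; have [exh _] := ovh.
have [_ lh _ _] := unknownE pr uh.
have lth : lo h < pr t := le_lt_trans (bot _ ova) lta.
exists h => //; split; last exact: (witness_bottom SE lo_hi box_pr stA ovh bot).
rewrite inE; apply/asboolP => F.
apply: (exch_forced_dual SE lo_hi bA exh lh box_pr) => // [g /stA.2[_ _ _ /(_ uh) circ]|g exg _].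
  exact: circ.
rewrite ltNge; apply/negP => le.
have ov' : ov t g by apply: (overlapI lo_hi exg pp pp); apply: le_lt_trans le lth.
have [_ ug _] := overlap_unknown lo_hi box_pr stA ov'.
by have := le_trans le (bot _ ov'); rewrite leNgt (unknown_range ug pp).
Qed.

Let tail_up t a : hits_up t a -> t \notin mand.
Proof.
case/good_up=> h _ [hM w]; apply/negP => tM; apply: no_pair.
by exists h, t.
Qed.

Let tail_down t a : hits_down t a -> t \notin mand.
Proof.
case/good_down=> h _ [hM w]; apply/negP => tM; apply: no_pair.
by exists t, h.
Qed.

Let not_mandatory t : t \notin mand -> exists2 F, feas F pr & t \notin F.
Proof.
move=> tM; apply: contrapT => nex; case/negP: tM; rewrite inE; apply/asboolP => F kF.
by apply: contraT => tF; case: nex; exists F.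
Qed.

(* By exchange, a counterexample has another one with a smaller prediction. *)
Let below_tail t a h : hits_up t a -> ov h t -> pr h <= lo t.
Proof.
move=> hta ovt; rewrite leNgt; apply/negP => lt0.
pose bad t := `[< exists a h, [/\ hits_up t a, ov h t & lo t < pr h] >].
have bt : bad t by apply/asboolP; exists a, h.
have [m /asboolP[a' [h' [hma ovm ltm]]] minm] := @arg_minP _ _ _ t bad pr bt.
have [F kF mF] := not_mandatory (tail_up hma).
have [uh um _] := overlap_unknown lo_hi box_pr stA ovm; have [exm _] := ovm.
have [_ lm _ _] := unknownE pr um.
have [g exg lg] := exch_escape SE bA exm lm box_pr
  (fun h'' ex => let: And4 _ _ _ c := stA.2 h'' m ex in c um pr pp) kF mF ltm.
have lgh : pr g < pr h' := le_lt_trans lg ltm.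
have ovg : ov h' g by apply: (overlapI lo_hi exg pp pp).
have [_ ug _] := overlap_unknown lo_hi box_pr stA ovg.
have bg : bad g.
  apply/asboolP; exists h', h'; split=> //; last exact: lt_trans (unknown_range ug pp).1 lgh.
  by split=> //; apply: lt_trans lgh _; rewrite (unknown_range uh pp).
by have := le_trans (minm g bg) lg; rewrite leNgt (unknown_range um pp).
Qed.

Let above_tail t a h : hits_down t a -> ov t h -> hi t <= pr h.
Proof.
move=> hta ovt; rewrite leNgt; apply/negP => lt0.
pose bad t := `[< exists a h, [/\ hits_down t a, ov t h & pr h < hi t] >].
have bt : bad t by apply/asboolP; exists a, h.
have [m /asboolP[a' [h' [hma ovm ltm]]] maxm] := @arg_maxP _ _ _ t bad pr bt.
have [F kF mF] := not_mandatory (tail_down hma).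
have [um uh _] := overlap_unknown lo_hi box_pr stA ovm; have [exm _] := ovm.
have [_ lm _ _] := unknownE pr um.
have [g exg lg] := exch_escape_dual SE lo_hi bA exm lm box_pr
  (fun h'' ex => let: And4 _ _ c _ := stA.2 m h'' ex in c um pr pp) kF mF ltm.
have lgh : pr h' < pr g := lt_le_trans ltm lg.
have ovg : ov g h' by apply: (overlapI lo_hi exg pp pp).
have [ug _ _] := overlap_unknown lo_hi box_pr stA ovg.
have bg : bad g.
  apply/asboolP; exists h', h'; split=> //; last first.
    by apply: lt_trans lgh _; rewrite (unknown_range ug pp).
  by split=> //; apply: lt_trans lgh; rewrite (unknown_range uh pp).
by have := le_trans lg (maxm g bg); rewrite leNgt (unknown_range um pp).
Qed.

(** Among the heads of [t] outside [Q'], one with the largest upper limit would be forced: heads in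
    [Q'] have values at most [lo t] by [below_tail], and [pr t] is below this limit. *)
Let cause_up t a Q' : hits_up t a -> Q \subset Q' -> saturated box feas Q' pr ->
  t \in Q' -> a \in Q'.
Proof.
move=> hta sQ sat tQ'; apply: contraT => aQ'.
pose H h := `[< hits_up t h >] && (h \notin Q').
have Ha : H a by rewrite /H aQ' andbT; apply/asboolP.
have [m /andP[/asboolP [ovm ltm] mQ'] maxm] := @arg_maxP _ _ _ a H hi Ha.
case/negP: mQ'; apply: sat => y F py'.
have py : possible box Q pr y by apply: possible_sub py'.
have [um ut _] := overlap_unknown lo_hi box_pr stA ovm; have [exm _] := ovm.
have [_ lm _ _] := unknownE pr um.
have yt : y t = pr t by case: py' => _ ->.
apply: (exch_forced SE bA exm lm); first by case: py'.
- by move=> g /stA.2[_ _ /(_ um) cut _]; apply: cut.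
- move=> h exh _; rewrite ltNge; apply/negP => le.
  have ovh : ov h t.
    by apply: (overlapI lo_hi exh pp py); apply: lt_le_trans ltm le.
  have [uh _ _] := overlap_unknown lo_hi box_pr stA ovh.
  have lth : pr t < hi h.
    by apply: lt_trans ltm (le_lt_trans le _); rewrite (unknown_range uh py).
  case: (boolP (h \in Q')) => hQ'.
    have eh : y h = pr h by case: py' => _ ->.
    have l1 := below_tail hta ovh; have l2 := (unknown_range ut pp).1.
    by rewrite eh in le; lra.
  have Hh : H h by rewrite /H hQ' andbT; apply/asboolP.
  by have := le_trans (maxm h Hh) le; rewrite leNgt (unknown_range uh py).
- by rewrite yt.
Qed.

Let cause_down t a Q' : hits_down t a -> Q \subset Q' -> saturated box feas Q' pr ->
  t \in Q' -> a \in Q'.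
Proof.
move=> hta sQ sat tQ'; apply: contraT => aQ'.
pose H h := `[< hits_down t h >] && (h \notin Q').
have Ha : H a by rewrite /H aQ' andbT; apply/asboolP.
have [m /andP[/asboolP [ovm ltm] mQ'] minm] := @arg_minP _ _ _ a H lo Ha.
case/negP: mQ'; apply: sat => y F py'.
have py : possible box Q pr y by apply: possible_sub py'.
have [ut um _] := overlap_unknown lo_hi box_pr stA ovm; have [exm _] := ovm.
have [_ lm _ _] := unknownE pr um.
have yt : y t = pr t by case: py' => _ ->.
apply: (exch_forced_dual SE lo_hi bA exm lm); first by case: py'.
- by move=> h /stA.2[_ _ _ /(_ um) circ]; apply: circ.
- move=> g exg _; rewrite ltNge; apply/negP => le.
  have ovg : ov t g.
    by apply: (overlapI lo_hi exg py pp); apply: le_lt_trans le ltm.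
  have [_ ug _] := overlap_unknown lo_hi box_pr stA ovg.
  have lth : lo g < pr t.
    by apply: lt_trans ltm; apply: lt_le_trans le; rewrite (unknown_range ug py).
  case: (boolP (g \in Q')) => gQ'.
    have eg : y g = pr g by case: py' => _ ->.
    have l1 := above_tail hta ovg; have l2 := (unknown_range ut pp).2.
    by rewrite eg in le; lra.
  have Hg : H g by rewrite /H gQ' andbT; apply/asboolP.
  by have := le_trans le (minm g Hg); rewrite leNgt (unknown_range ug py).
- by rewrite yt.
Qed.

Let hits t a := hits_up t a \/ hits_down t a.

Let cause t a Q' : hits t a -> Q \subset Q' -> saturated box feas Q' pr ->
  t \in Q' -> a \in Q'.
Proof. by case; [apply: cause_up | apply: cause_down]. Qed.

Let tail_notin t a : hits t a -> t \notin mand.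
Proof. by case=> [/tail_up|/tail_down]. Qed.

Let good_head t a : hits t a -> exists2 h, hits t h & h \in mand /\ wit t h.
Proof.
case=> [/good_up|/good_down] [h hth [hM w]]; exists h; try by [left | right].
  by split=> //; apply: witnessC.
by [].
Qed.

Let hits_notin t a : hits t a -> (a \notin Q) * (t \notin Q) * (a != t).
Proof.
case=> -[ovl _]; have [/andP[q1 _] /andP[q2 _] _] := overlap_unknown lo_hi box_pr stA ovl;
  have [/exch_neq ne _] := ovl; by rewrite q1 q2 // eq_sym.
Qed.

(** [cause] is applied to [Q :|: (t |: mand)], which is saturated because it contains [mand]. *)
Let head_mandatory t a : hits t a -> a \in mand.
Proof.
move=> hta; have [[aQ _] at_] := hits_notin hta.
have : a \in Q :|: (t |: mand).
  apply: (cause hta); rewrite ?subsetUl // ?in_setU ?in_set1 ?eqxx ?orbT //.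
  apply: saturated_mandatory => //.
  by rewrite setUA subsetUr.
by rewrite in_setU in_setU1 (negbTE aQ) (negbTE at_).
Qed.

Let tail_exists a : a \in mand :\: Q -> exists t, hits t a.
Proof.
case/setDP=> aM aQ; have ua := mandatory_unknown aM aQ; have [_ la _ _] := unknownE pr ua.
apply: contrapT => nt; have := mandatoryP aM; move=> /(_ (~: [set a])); rewrite !inE eqxx.
suff kn : feas (~: [set a]) pr by move=> /(_ kn).
have [_ _ cla cha] := unknownE pr ua.
case: (boolP (a \in A)) => aA.
  apply: (known_without SE bas_exists bA aA la box_pr) => f ex.
  rewrite leNgt; apply/negP => lt; apply: nt; exists f; left; split=> //; split=> //.
  by rewrite cha; apply: le_lt_trans lt; rewrite (cur_range lo_hi f pp).
apply: (known_without_dual SE bas_exists lo_hi bA aA la box_pr) => e ex.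
rewrite leNgt; apply/negP => lt; apply: nt; exists e; right; split=> //; split=> //.
by rewrite cla; apply: lt_le_trans lt _; rewrite (cur_range lo_hi e pp).
Qed.

Let G := [rel u w | `[< ov u w >] || `[< ov w u >]].
Let U := ~: (Q :|: mand).

Let notin_U t a : hits t a -> a \notin U.
Proof. by move/head_mandatory=> aM; rewrite in_setC in_setU aM orbT. Qed.

(** An uncovered edge would give, by [overlap_uncovered], an element hitting one of its ends, which
    would then be mandatory and not in [U]. *)
Let covers_pr F : feas F pr -> covers G U F.
Proof.
move=> kF u w uU wU /= Guw; wlog /asboolP ovl : u w uU wU Guw / `[< ov u w >] => [hw|].
  by case/orP: (Guw) => h; [|rewrite orbC]; apply: hw; rewrite // h ?orbT.
apply: contraT; rewrite negb_or => /andP[uF wF].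
have [h ovh le] := overlap_uncovered SE lo_hi box_pr stA ovl pp kF uF wF.
have [_ _ lt] := overlap_unknown lo_hi box_pr stA ovl.
have /notin_U : hits h w by right; split=> //; apply: lt_le_trans lt le.
by rewrite wU.
Qed.

(** The settled basis [A] remains optimal. If one end of an overlap is queried and its prediction
    does not already decide the comparison, it hits the other end; that end is then mandatory, and
    [above_tail] or [below_tail] locates its value. *)
Let feas_cover C : C \subset U -> covers G U C -> feas (Q :|: mand :|: C) pr.
Proof.
move=> sC cov; apply: (settled_known lo_hi stA); first by rewrite -setUA subsetUl.
set K := _ :|: C => z bz ez e f ovl.
have pz : possible box Q pr z by split=> // i iQ; rewrite ez // !in_setU iQ.
have mK a : a \in mand -> a \in K by move=> aM; rewrite !in_setU aM orbT.
have nU i : i \notin K -> (i \in U) * (i \notin C).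
  by rewrite in_setU negb_or -in_setC => /andP[-> ->].
have [ue uf _] := overlap_unknown lo_hi box_pr stA ovl.
have ze := unknown_range ue pz; have zf := unknown_range uf pz.
case: (boolP (e \in K)) => eK.
  have eze := ez e eK; case: (leP (pr e) (lo f)) => [le|lt].
    by rewrite eze; apply: le_trans le (ltW zf.1).
  have hef : hits_down e f by [].
  have fK : f \in K by apply/mK/(@head_mandatory e); right.
  by rewrite (ez f fK); apply: le_trans (ltW ze.2) (above_tail hef ovl).
case: (boolP (f \in K)) => fK.
  case: (leP (hi e) (pr f)) => [le|lt]; first by rewrite (ez f fK); apply: le_trans (ltW ze.2) le.
  have hfe : hits_up f e by [].
  by case/negP: eK; apply/mK/(@head_mandatory f); left.
have [eU eC] := nU e eK; have [fU fC] := nU f fK.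
have := cov e f eU fU; rewrite /= (negbTE eC) (negbTE fC) => /(_ _)/negP[] //.
by rewrite (asboolT ovl).
Qed.

(** The sides are [A] and its complement. The next [c] has the largest upper limit in [X :&: A], or
    the smallest lower limit in [X] if [X] misses [A]. If [c] and a neighbour [f] were both avoided,
    an overlap of [f] would have a value beyond the limit of [c]; the extremal choice puts it
    outside [X], so this value is its prediction and it hits [f], contrary to [f] in [U]. *)
Let bipartite : bipartite_residual box feas pr Q G.
Proof.
exists [pred i | i \in A]; split=> [u w|C X sC cov sXC X0] /=.
  by case/orP => /asboolP[[uA wA _] _]; rewrite uA (negbTE wA).
have nbr_in_C f h : f \in U :\: C -> h \in U -> G f h -> h \in C.
  by case/setDP=> fU fC hU Gfh; have := cov f h fU hU Gfh; rewrite (negbTE fC).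
have known_value y f h : f \in U :\: C -> unknown lo hi Q h -> G f h -> h \notin X ->
    possible box (Q :|: mand :|: (C :\: X)) pr y -> y h = pr h.
  move=> fU /andP[hQ _] Gfh hX [_ ag]; rewrite ag //.
  case: (boolP (h \in mand)) => hM; first by rewrite !in_setU hM orbT.
  have hU : h \in U by rewrite in_setC in_setU negb_or hQ.
  by rewrite in_setU in_setD hX (nbr_in_C f h) // orbT.
have sub y : possible box (Q :|: mand :|: (C :\: X)) pr y -> possible box Q pr y.
  by apply: possible_sub; rewrite -setUA subsetUl.
have [XA|[c0 /setIP[c0X c0A]]] := set_0Vmem (X :&: A).
  have [c0 c0X] := set0Pn _ X0.
  have [c cX minc] := @arg_minP _ _ _ c0 (mem X) lo c0X.
  have cA : c \notin A.
    by apply/negP => cA; have := in_set0 c; rewrite -XA in_setI cA [c \in X]cX.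
  exists c => // f fU Gcf y F py kF.
  have ovl : ov f c by case/orP: Gcf => /asboolP // -[[cA' _ _] _]; rewrite cA' in cA.
  apply: contraT; rewrite negb_or => /andP[cF fF].
  have [g ovg le] := overlap_uncovered_dual SE lo_hi box_pr stA ovl (sub y py) kF fF cF.
  have [_ ug _] := overlap_unknown lo_hi box_pr stA ovg.
  have [_ _ lt] := overlap_unknown lo_hi box_pr stA ovl.
  have Gfg : G f g by rewrite /= (asboolT ovg).
  have gX : g \notin X.
    apply/negP => gX; have := le_trans le (minc g gX).
    by rewrite leNgt (unknown_range ug (sub y py)).
  have yg := known_value y f g fU ug Gfg gX py.
  have /notin_U : hits g f by left; split=> //; rewrite -yg; apply: le_lt_trans le lt.
  by case/setDP: fU => ->.
have Xc0 : (mem (X :&: A)) c0 by rewrite inE /= in_setI c0X.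
have [c /setIP[cX cA] maxc] := @arg_maxP _ _ _ c0 (mem (X :&: A)) hi Xc0.
exists c => // f fU Gcf y F py kF.
have ovl : ov c f by case/orP: Gcf => /asboolP // -[[_ cA' _] _]; rewrite cA in cA'.
apply: contraT; rewrite negb_or => /andP[cF fF].
have [h ovh le] := overlap_uncovered SE lo_hi box_pr stA ovl (sub y py) kF cF fF.
have [uh _ _] := overlap_unknown lo_hi box_pr stA ovh.
have [_ _ lt] := overlap_unknown lo_hi box_pr stA ovl.
have Gfh : G f h by rewrite /= (asboolT ovh) orbT.
have hX : h \notin X.
  apply/negP => hX; have hXA : mem (X :&: A) h.
    by rewrite inE /= in_setI hX; case: ovh => -[].
  by have := le_trans (maxc h hXA) le; rewrite leNgt (unknown_range uh (sub y py)).
have yh := known_value y f h fU uh Gfh hX py.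
have /notin_U : hits h f by right; split=> //; rewrite -yh; apply: lt_le_trans lt le.
by case/setDP: fU => ->.
Qed.

Lemma settled_fork_or_terminal : mandatory_fork box feas pr Q \/ terminal box feas pr Q.
Proof.
case: (pselect (exists t a a', [/\ hits t a, hits t a' & a != a'])) => [|nofork].
  case=> t [a [a' [hta hta' ne]]]; left.
  have [h hth [hM w]] := good_head hta.
  have [a1 hta1 ne1] : exists2 a1, hits t a1 & h != a1.
    by case: (eqVneq h a) => [->|?]; [exists a' | exists a].
  exists t, h, a1; split=> //.
  - by rewrite in_setD (head_mandatory hta1) (hits_notin hta1).
  - exact: tail_notin hta.
  split=> // Q' sQ sat tQ'; exact: cause hta1 sQ sat tQ'.
apply: (fork_or_terminal (G := G)) => //.
  by split=> //; [move=> u w /=; rewrite orbC | right; apply: bipartite].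
move=> a /tail_exists[t hta]; exists t; split; last by move=> Q'; apply: cause hta.
have [h hth [_ w]] := good_head hta; apply: witnessC.
(* Without forks [t] has a single head, so [a] is the witness partner provided by [good_head]. *)
rewrite (_ : a = h) //; apply/eqP; apply: contraT => ne.
by case: nofork; exists t, a, h.
Qed.

End Residual_of_settled.
Theorem winning_basis : winning box feas pr set0 pr.
Proof.
apply: winning_start => //.
- by move=> Q v y; apply: feas_agree.
- by move=> Q v; apply: basis_witness.
move=> Q sat; case: (pselect (mandatory_pair box feas pr Q)) => [mp|nmp].
  exact: Or31.
have [A stA] := settled_exists SE bas_exists lo_hi box_pr sat.
by case: (settled_fork_or_terminal stA nmp); [apply: Or32 | apply: Or33].
Qed.

End OneMatroid.

(** * Minima of a family of sets *)

Section Minima.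
Local Open Scope ring_scope.
Variables (R : realType) (T : finType) (fam : {set {set T}}) (lo hi pr : T -> R).
Hypothesis lo_hi : forall e, lo e <= hi e.
Notation box := (in_box lo hi).
Hypothesis box_pr : box pr.
Hypothesis fam0 : set0 \notin fam.
Implicit Types (A B F Q C S : {set T}) (e f g h m a d : T) (v x y z : T -> R).

(** The bases of the rank 1 uniform matroid on [S]: its optimal bases are the minima of [S], so the
    results on bases apply to each set of the family. *)
Definition singles S A := exists2 i, i \in S & A = [set i].

Notation feas1 S := (basis_known (singles S) lo hi).
Definition minima_known Q y := forall S, S \in fam -> feas1 S Q y.
Notation feas := minima_known.
Notation mand := (mandatory feas pr).

Lemma exch_singles S m e f : m \in S ->
  exch (singles S) [set m] e f <-> [/\ e = m, f != m & f \in S].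
Proof.
move=> mS; split=> [[]|[-> fm fS]]; last first.
  split; rewrite ?inE //; exists f => //.
  by apply/setP => i; rewrite !inE andNb orbF.
rewrite !inE => /eqP-> fm [i iS e1]; split=> //.
suff -> : f = i by [].
by apply/eqP; have := setU11 f ([set m] :\ m); rewrite e1 inE.
Qed.

Lemma singles_exchange S : symmetric_exchange (singles S).
Proof.
move=> A B e [i iS ->] [j jS ->]; rewrite !inE => /eqP-> ij.
by exists j; split; [apply/(exch_singles _ _ iS) | apply/(exch_singles _ _ jS)];
  split=> //; rewrite eq_sym.
Qed.

Lemma singles_exist S : S \in fam -> exists A, singles S A.
Proof.
move=> SF; have [e|[i iS]] := set_0Vmem S; last by exists [set i], i.
by move: fam0; rewrite -e SF.
Qed.

Lemma saturated_single S Q v : S \in fam ->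
  saturated box feas Q v -> saturated box (feas1 S) Q v.
Proof. by move=> SF sat i fi; apply: sat => y F py kF; apply: fi py (kF S SF). Qed.

Lemma witness_single S Q v i j : S \in fam ->
  witness box (feas1 S) Q v i j -> witness box feas Q v i j.
Proof. by move=> SF [? ? ? w]; split=> // y F py kF; apply: w py (kF S SF). Qed.

Lemma settled_single S Q v A : S \in fam -> settled (singles S) lo hi Q v A ->
  exists2 m, m \in S & A = [set m].
Proof. by move=> SF [[m mS ->] _]; exists m. Qed.

Section Star.
Variables (S Q : {set T}) (v : T -> R) (m : T).
Hypotheses (SF : S \in fam) (bv : box v) (mS : m \in S).
Hypothesis stm : settled (singles S) lo hi Q v [set m].
Notation ov := (overlap (singles S) lo hi Q v [set m]).

Lemma star_center e f : ov e f -> e = m.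
Proof. by case=> /(exch_singles _ _ mS)[]. Qed.

(** All overlaps in [S] share the center [m], so [m] trivially has the largest upper limit in
    [witness_top]. *)
Lemma star_witness f : ov m f -> witness box feas Q v m f.
Proof.
move=> ovf; apply: (witness_single SF); apply: (witness_top _ lo_hi bv stm ovf).
  exact: singles_exchange.
by move=> h /star_center ->.
Qed.

(* A new center [m'] would satisfy [hi m' <= v' m < hi m <= hi m']. *)
Lemma star_solved Q' v' : Q \subset Q' -> possible box Q v v' ->
  saturated box feas Q' v' -> unknown lo hi Q m -> m \in Q' -> feas1 S Q' v'.
Proof.
move=> sQ [bv' ag] sat um mQ'.
have [A' stA'] := settled_exists (@singles_exchange S) (singles_exist SF) lo_hi bv'
  (saturated_single SF sat).
have [m' m'S eA'] := settled_single SF stA'; rewrite {A'}eA' in stA'.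
apply: (settled_known lo_hi stA') => // z _ _ e f ovl; exfalso.
have [] := overlap_unknown lo_hi bv' stA' ovl; have [/(exch_singles _ _ m'S)[-> _ _] _] := ovl.
move=> um' _ _; have ne : m' != m.
  by apply: contraTneq um' => ->; rewrite /unknown mQ'.
have um'Q : unknown lo hi Q m'.
  case/andP: um' => m'Q' lm'; rewrite /unknown lm' andbT.
  by apply: contra m'Q'; apply: (subsetP sQ).
have [_ le1 _ _] := stm.2 m m' ((exch_singles _ _ mS).2 (And3 erefl ne m'S)).
have ne' : m != m' by rewrite eq_sym.
have [_ le2 _ _] := stA'.2 m' m ((exch_singles _ _ m'S).2 (And3 erefl ne' mS)).
have [_ _ _ h1] := unknownE v um; have [_ _ _ h2] := unknownE v um'Q.
have [_ _ _ h3] := unknownE v' um'.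
have lt := (unknown_range um (conj bv' ag)).2.
move: le1 le2; rewrite h1 h2 h3 /cur_hi mQ' => le1 le2.
by have := le_trans le1 le2; rewrite leNgt lt.
Qed.

End Star.

Lemma minima_agree Q v y : box v -> possible box Q v y -> feas Q v -> feas Q y.
Proof. by move=> bv py kQ S SF; apply: feas_agree py (kQ S SF). Qed.

Lemma star_exists S Q v : S \in fam -> box v -> saturated box feas Q v ->
  exists2 m, m \in S & settled (singles S) lo hi Q v [set m].
Proof.
move=> SF bv sat.
have [A stA] := settled_exists (@singles_exchange S) (singles_exist SF) lo_hi bv
  (saturated_single SF sat).
by have [m mS e] := settled_single SF stA; exists m; rewrite // -e.
Qed.

Lemma minima_witness Q v : box v -> saturated box feas Q v -> ~ feas Q v ->
  exists i j, witness box feas Q v i j.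
Proof.
move=> bv sat nf.
have [S SF nS] : exists2 S, S \in fam & ~ feas1 S Q v.
  by apply: contrapT => nex; apply: nf => S SF; apply: contrapT => nS; apply: nex; exists S.
have [i [j w]] := basis_witness (@singles_exchange S) (singles_exist SF) lo_hi bv
  (saturated_single SF sat) nS.
by exists i, j; apply: witness_single w.
Qed.

Section Trichotomy.
Variable Q : {set T}.
Hypothesis sat : saturated box feas Q pr.
Let pp : possible box Q pr pr. Proof. by []. Qed.

(** [a] is already mandatory for a single set [S]. If it is the center, some prediction below [hi a]
    is a cause, or else [known_without] would apply. If it is not, the center is a cause: once it is
    queried in a saturated position, [S] is solved by [star_solved]. *)
Lemma minima_cause a : a \in mand :\: Q -> exists d, causes box feas pr Q d a.
Proof.
case/setDP=> aM aQ.
have [S SF nS] : exists2 S, S \in fam & ~ feas1 S (~: [set a]) pr.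
  apply: contrapT => nex; have := @mandatoryP _ _ feas pr a (~: [set a]) aM.
  rewrite !inE eqxx => /(_ _)/negP; apply=> // S SF.
  by apply: contrapT => nS; apply: nex; exists S.
have a_in F : feas1 S F pr -> a \in F.
  move=> kF; apply: contraT => aF; case: nS; apply: feas_sub kF.
  by apply/subsetP => i iF; rewrite !inE; apply: contraNneq aF => <-.
have aM1 : a \in mandatory (feas1 S) pr by rewrite inE; apply/asboolP.
have bS := singles_exist SF; have SE := @singles_exchange S.
have ua := mandatory_unknown bS lo_hi box_pr aM1 aQ.
have [_ la cla cha] := unknownE pr ua.
have [m mS stm] := star_exists SF box_pr sat.
have bm := stm.1.
case: (eqVneq a m) => [am|am].
  rewrite {}am in aM aQ a_in aM1 ua la cla cha nS *.
  have [f ovf lf] : exists2 f, overlap (singles S) lo hi Q pr [set m] m f & pr f < hi m.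
    apply: contrapT => nex; apply: nS; apply: (known_without SE bS bm _ la box_pr).
      by rewrite inE.
    move=> f ex; rewrite leNgt; apply/negP => lt; apply: nex; exists f => //; split=> //.
    by rewrite cha; apply: le_lt_trans lt; rewrite (cur_range lo_hi f pp).
  exists f; split; first exact: (star_witness SF box_pr mS stm ovf).
  move=> Q' sQ sat' fQ'; apply: sat' => y F py' kF.
  have py : possible box Q pr y by apply: possible_sub py'.
  apply: (exch_forced SE bm ovf.1 la _ _ _ _ (kF S SF)); first by case: py'.
  - by move=> g /stm.2[_ _ /(_ ua) cut _]; apply: cut.
  - by move=> h /(exch_singles _ _ mS)[-> _ _]; rewrite eqxx.
  - by have [_ <-] := py'.
have [e ovl] : exists e, overlap (singles S) lo hi Q pr [set m] e a.
  apply: contrapT => nex; apply: nS; apply: (known_without_dual SE bS lo_hi bm _ la box_pr).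
    by rewrite inE.
  move=> e ex; rewrite leNgt; apply/negP => lt; apply: nex; exists e; split=> //.
  by rewrite cla; apply: lt_le_trans lt _; rewrite (cur_range lo_hi e pp).
have em := star_center mS ovl; rewrite {e}em in ovl.
have [um _ _] := overlap_unknown lo_hi box_pr stm ovl.
exists m; split; first by apply: witnessC; apply: (star_witness SF box_pr mS stm ovl).
move=> Q' sQ sat' mQ'; apply: a_in.
exact: (star_solved SF mS stm sQ pp sat' um mQ').
Qed.

Let Gr := [rel u w | `[< exists S m, [/\ S \in fam, m \in S,
  settled (singles S) lo hi Q pr [set m]
  & overlap (singles S) lo hi Q pr [set m] u w
    \/ overlap (singles S) lo hi Q pr [set m] w u] >]].
Let U := ~: (Q :|: mand).

(** The edges are witness pairs by [star_witness]. If the center [m] of [S] stays unqueried, the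
    cover contains all its unqueried overlaps in [U], so the other unqueried elements of [S] start
    at or above [hi m]; hence a later center has no overlap left. *)
Let Gr_static : static_residual box feas pr Q Gr.
Proof.
split=> [y F py kF u w _ _ /asboolP[S [m [SF mS stm ovl]]]|Q' y py sQM sat' cov S SF].
  wlog ovuw : u w ovl / overlap (singles S) lo hi Q pr [set m] u w => [hw|].
    by case: (ovl) => o; [|rewrite orbC]; apply: hw => //; case: ovl; [right|left].
  have e := star_center mS ovuw; rewrite {u ovl}e in ovuw *.
  by have [_ _ _ wit] := star_witness SF box_pr mS stm ovuw; apply: wit py kF.
have sQ : Q \subset Q' by apply: subset_trans sQM; apply: subsetUl.
have [m mS stm] := star_exists SF box_pr sat.
have [by_ ag] := py.
case: (boolP (unknown lo hi Q m)) => um; last first.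
  apply: feas_sub sQ _; apply: feas_agree (py) _ => //.
  apply: (settled_known lo_hi stm) => // z _ _ e f ovl; exfalso.
  have em := star_center mS ovl; rewrite {e}em in ovl.
  by have [] := overlap_unknown lo_hi box_pr stm ovl; rewrite (negbTE um).
case: (boolP (m \in Q')) => mQ'; first exact: (star_solved SF mS stm sQ py sat' um mQ').
have nQ' i : i \notin Q' -> (i \in U) * (i \notin Q).
  move=> iQ'; have : i \notin Q :|: mand by apply: contra iQ'; apply: (subsetP sQM).
  by rewrite in_setC => niQM; split=> //; apply: contra niQM; rewrite in_setU => ->.
have covm i : i \notin Q' -> i != m -> i \in S -> ~ lo i < hi m.
  move=> iQ' im iS lt; have [iU iQ] := nQ' i iQ'; have [mU mQ] := nQ' m mQ'.
  suff Gmi : Gr m i by have := cov m i mU iU Gmi; rewrite (negbTE mQ') (negbTE iQ').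
  apply/asboolP; exists S, m; split=> //; left; split.
    by apply/(exch_singles _ _ mS).
  by have [_ _ _ ->] := unknownE pr um; rewrite /cur_lo (negbTE iQ).
have [m' m'S stm'] := star_exists SF by_ sat'.
apply: (settled_known lo_hi stm') => // z _ _ e f ovl; exfalso.
have em := star_center m'S ovl; rewrite {e}em in ovl.
have [um' uf lf] := overlap_unknown lo_hi by_ stm' ovl.
have [fQ' _] := andP uf; have [m'Q' _] := andP um'.
have [/(exch_singles _ _ m'S)[_ fm fS] _] := ovl.
case: (eqVneq m' m) => [em|ne]; first by apply: (covm f) => //; rewrite -em.
apply: (covm m') => //.
have ne' : m != m' by rewrite eq_sym.
have [le _ _ _] := stm'.2 m' m ((exch_singles _ _ m'S).2 (And3 erefl ne' mS)).
move: le; rewrite /cur_lo (negbTE m'Q') (negbTE mQ') => le.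
by apply: le_lt_trans le _; case/andP: um.
Qed.

Lemma minima_fork_or_terminal : ~ mandatory_pair box feas pr Q ->
  mandatory_fork box feas pr Q \/ terminal box feas pr Q.
Proof.
move=> nopair; apply: (fork_or_terminal (G := Gr)) nopair _ _; last exact: minima_cause.
have [cov solved] := Gr_static; split; last by left.
- by move=> u w; apply/asboolP/asboolP => -[S [m [? ? ? []]]];
    exists S, m; split=> //; [right | left | right | left].
- by move=> F kF; apply: cov kF.
move=> C sC covC; apply: solved => //; first exact: subsetUl.
  by apply: saturated_mandatory => //; rewrite -setUA setUCA subsetUl.
by move=> u w uU wU Guw; have := covC u w uU wU Guw; rewrite !in_setU => /orP[->|->]; rewrite !orbT.
Qed.

End Trichotomy.

Theorem winning_minima : winning box feas pr set0 pr.
Proof.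
apply: winning_start => //.
- exact: minima_agree.
- exact: minima_witness.
move=> Q sat; case: (pselect (mandatory_pair box feas pr Q)) => [mp|nmp].
  exact: Or31.
by case: (minima_fork_or_terminal sat nmp); [apply: Or32 | apply: Or33].
Qed.

End Minima.

(** * Spanning trees *)

Section SpanningTrees.
Variables (T V : finType) (ends : T -> {set V}).
Hypothesis ends_card : forall e, #|ends e| = 2%N.
Implicit Types (A B D : {set T}) (e f g : T) (u v w x y q s t : V).

Notation conn A := (connect (adjacent ends A)).

Lemma eq_set2 x y u v : [set x; y] = [set u; v] -> (x = u /\ y = v) \/ (x = v /\ y = u).
Proof.
move=> e; have xuv : x \in [set u; v] by rewrite -e set21.
have yuv : y \in [set u; v] by rewrite -e set22.
have uxy : u \in [set x; y] by rewrite e set21.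
have vxy : v \in [set x; y] by rewrite e set22.
case: (eqVneq x u) => [xu|xu].
  left; split=> //; case/set2P: vxy => [vx|->] //.
  by case/set2P: yuv => -> //; rewrite vx.
right; split; first by case/set2P: xuv => // xu'; rewrite xu' eqxx in xu.
by case/set2P: uxy => // ux; rewrite ux eqxx in xu.
Qed.

Lemma endsP e : exists u v, u != v /\ ends e = [set u; v].
Proof. by apply/cards2P; rewrite ends_card. Qed.

Lemma adjacentP A x y :
  reflect (exists2 e, e \in A & ends e = [set x; y]) (adjacent ends A x y).
Proof.
by apply: (iffP exists_inP) => -[e eA /eqP ee]; exists e => //; apply/eqP.
Qed.

Lemma adjacent_sym A : symmetric (adjacent ends A).
Proof. by move=> x y; rewrite /adjacent setUC. Qed.

Lemma connC A x y : conn A x y = conn A y x.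
Proof. exact: (sym_connect_sym (@adjacent_sym A)). Qed.

Lemma conn_trans A y x z : conn A x y -> conn A y z -> conn A x z.
Proof. exact: connect_trans. Qed.

Lemma conn_edge A e x y : e \in A -> ends e = [set x; y] -> conn A x y.
Proof. by move=> eA ee; apply: connect1; apply/adjacentP; exists e. Qed.

Lemma conn_sub A B x y : A \subset B -> conn A x y -> conn B x y.
Proof.
move=> sAB; apply: connect_sub => {}x {}y /adjacentP[e eA ee].
exact: conn_edge (subsetP sAB e eA) ee.
Qed.

Lemma conn_ind (P : V -> Prop) A u w : P u ->
  (forall x y, P x -> adjacent ends A x y -> P y) -> conn A u w -> P w.
Proof.
move=> Pu step /connectP[p pth ->] {w}; elim: p u Pu pth => //= y p IHp u Pu /andP[uy pth].
by apply: IHp pth; apply: step uy.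
Qed.

(** A description of spanning trees by connectivity alone, which makes exchanges easier to follow
    than cycles; [spanning_treeP] relates the two. *)
Definition minimal_spanning A := spans ends A /\ forall e, e \in A -> ~ spans ends (A :\ e).

Lemma spans_without A e u v : spans ends A -> ends e = [set u; v] ->
  conn (A :\ e) u v -> spans ends (A :\ e).
Proof.
move=> spA ee cuv x y; apply: connect_sub (spA x y) => {}x {}y /adjacentP[g gA eg].
case: (eqVneq g e) => [ge|ge]; last by apply: conn_edge eg; rewrite !inE ge.
by rewrite ge ee in eg; case: (eq_set2 eg) => -[<- <-] //; rewrite connC.
Qed.

Lemma two_sides A e u v w : spans ends A -> ends e = [set u; v] ->
  conn (A :\ e) u w \/ conn (A :\ e) v w.
Proof.
move=> spA ee.
apply: (@conn_ind (fun w => conn (A :\ e) u w \/ conn (A :\ e) v w) A u w) => //.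
  by left.
move=> x y Px /adjacentP[g gA eg]; case: (eqVneq g e) => [ge|ge].
  rewrite ge ee in eg; case: (eq_set2 eg) => -[eu ev]; [right | left].
    by rewrite ev.
  by rewrite eu.
have xy : conn (A :\ e) x y by apply: conn_edge eg; rewrite !inE ge.
by case: Px => Px; [left | right]; apply: conn_trans xy.
Qed.

Lemma path_avoid B f x p z : z \in ends f -> z \notin x :: p ->
  path (adjacent ends B) x p -> path (adjacent ends (B :\ f)) x p.
Proof.
move=> zf; elim: p x => //= y p IHp x; rewrite inE negb_or => /andP[zx zyp] /andP[xy pth].
rewrite IHp // andbT; case/adjacentP: xy => g gB eg; apply/adjacentP; exists g => //.
rewrite !inE gB andbT; apply: contraTneq zf => <-; rewrite eg !inE negb_or zx.
by apply: contraNneq zyp => ->; rewrite mem_head.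
Qed.

Lemma path_exit (r : rel V) (X : pred V) x p : path r x p -> X x -> ~~ X (last x p) ->
  exists p1 w p2, [/\ p = p1 ++ w :: p2, X (last x p1) & ~~ X w].
Proof.
elim: p x => [|y p IHp] x /=; first by move=> _ ->.
case/andP=> _ pth Xx nX; case: (boolP (X y)) => Xy; last by exists [::], y, p.
have [p1 [w [p2 [-> X1 nw]]]] := IHp y pth Xy nX.
by exists (y :: p1), w, p2.
Qed.

(** A simple path leaves [X] through some edge [f]. The parts before and after avoid [f], as each
    misses one of its ends. *)
Lemma crossing_edge B (X : pred V) u v : conn B u v -> X u -> ~~ X v ->
  exists f q w, [/\ f \in B, ends f = [set q; w], X q, ~~ X w
    & conn (B :\ f) u q /\ conn (B :\ f) w v].
Proof.
case/connectP=> p0 pth0 ->; case/shortenP: pth0 => p pth up _ Xu nX.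
have [p1 [w [p2 [ep Xq nw]]]] := path_exit pth Xu nX.
subst p; rewrite last_cat /=.
move: pth up; rewrite cat_path -cat_cons cat_uniq.
case/and3P=> pth1 /adjacentP[f fB ef] pth2 /and3P[_ /hasPn dj _].
exists f, (last u p1), w; split=> //; split.
  apply/connectP; exists p1 => //; apply: (path_avoid (z := w)) pth1; first by rewrite ef set22.
  by apply: dj; rewrite mem_head.
apply/connectP; exists p2 => //.
apply: (path_avoid (z := last u p1)) pth2; first by rewrite ef set21.
by apply/negP => /dj; rewrite mem_last.
Qed.

Lemma minimal_spanning_swap A e f u v q w : minimal_spanning A -> e \in A ->
  ends e = [set u; v] -> ends f = [set q; w] ->
  conn (A :\ e) u q -> ~~ conn (A :\ e) u w -> minimal_spanning (f |: A :\ e).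
Proof.
move=> [spA minA] eA ee ef cq ncw.
have sA : A :\ e \subset f |: A :\ e by apply: subsetUr.
have fA : f \notin A :\ e.
  by apply: contra ncw => fA; apply: conn_trans cq (conn_edge fA ef).
have cvw : conn (A :\ e) v w by case: (two_sides w spA ee) => // cw; rewrite cw in ncw.
have cuv : conn (f |: A :\ e) u v.
  apply: conn_trans (conn_sub sA cq) _.
  apply: conn_trans (conn_edge (setU11 f _) ef) _.
  by rewrite connC; apply: conn_sub cvw.
split=> [x y|g].
  have cu z : conn (f |: A :\ e) u z.
    case: (two_sides z spA ee) => /(conn_sub sA) // cz; exact: conn_trans cuv cz.
  by apply: conn_trans (cu y); rewrite connC.
rewrite in_setU1 => /orP[/eqP-> sp|gA sp].
  by apply: (minA e eA); rewrite setU1K in sp.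
have [s [t [_ eg]]] := endsP g.
apply: (minA g); first by case/setD1P: gA.
apply: (spans_without spA eg).
pose X := conn (A :\ e) u; pose W := A :\ e :\ g.
have sideW x y : adjacent ends (A :\ e) x y -> X x = X y.
  move=> xy; apply/idP/idP => h; first exact: conn_trans h (connect1 xy).
  by apply: conn_trans h (connect1 _); rewrite adjacent_sym.
have sideg : X s = X t by apply: sideW; apply/adjacentP; exists g.
pose p0 := if X s then q else w.
(* Projects a walk to the side of [s]: on the other side only [p0] is remembered, the end of [f]
   through which the walk left and has to return. A redundant [g] would thus be redundant already in
   [A]. *)
pose P x := if X x == X s then conn W s x else conn W s p0.
have Pt : P t.
  apply: (@conn_ind P ((f |: A :\ e) :\ g) s t) => //.
    by rewrite /P eqxx connect0.
  have Xq : X q = true by []. 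
  have Xw : X w = false by apply: negbTE.
  move=> x y Px /adjacentP[h]; rewrite !inE => /andP[hg /orP[/eqP->|/andP[he hA]]] eh.
    rewrite ef in eh; move: Px; rewrite /P /p0.
    by case: (eq_set2 eh) => -[<- <-]; rewrite Xq Xw; case: (X s).
  have xy : adjacent ends W x y by apply/adjacentP; exists h; rewrite // !inE hg he.
  have Xyx : X y = X x.
    by apply/esym/sideW; apply/adjacentP; exists h; rewrite // !inE he.
  by move: Px; rewrite /P Xyx; case: ifP => // _ Px; apply: conn_trans Px (connect1 xy).
move: Pt; rewrite /P sideg eqxx; apply: conn_sub.
by apply: setSD; apply: subsetDl.
Qed.

(** A simple path in [B] between the ends of [e] leaves a component of [A :\ e] through some [f].
    This [f] reconnects [A :\ e], and [e] bridges [B :\ f] through the rest of the path. *)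
Lemma minimal_spanning_exchange : symmetric_exchange minimal_spanning.
Proof.
move=> A B e mA mB eA eB; have [[spA minA] [spB minB]] := (mA, mB).
have [u [v [_ ee]]] := endsP e.
have nuv : ~~ conn (A :\ e) u v.
  by apply/negP => cuv; apply: (minA e eA); apply: spans_without spA ee cuv.
have [f [q [w [fB ef cuq nuw [cuq' cwv']]]]] :=
  crossing_edge (X := conn (A :\ e) u) (spB u v) (connect0 _ _) nuv.
have fe : f != e by apply: contraNneq eB => <-.
exists f; split; split=> //.
- apply: contra nuw => fA; apply: conn_trans cuq (conn_edge _ ef).
  by rewrite !inE fe.
- exact: minimal_spanning_swap mA eA ee ef cuq nuw.
- apply: (minimal_spanning_swap mB fB ef ee); first by rewrite connC.
  apply/negP => cqv; apply: (minB f fB); apply: spans_without spB ef _.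
  by apply: conn_trans cqv _; rewrite connC.
Qed.

Lemma minimal_spanning_exists : spans ends setT -> exists A, minimal_spanning A.
Proof.
move=> spT; pose P A := `[< spans ends A >]; have PT : P setT by apply/asboolP.
have [A /asboolP spA minA] := @arg_minnP _ setT P (fun A => #|A|) PT.
exists A; split=> // e eA /asboolP/minA; rewrite [X in (X <= _)%N](cardsD1 e) eA.
by rewrite ltnn.
Qed.

Let joins (p q : V * T) := ends p.2 == [set p.1; q.1].

Lemma conn_joins D p (s : seq (V * T)) z : path joins p (rcons s z) ->
  {subset [seq i.2 | i <- p :: s] <= D} -> conn D p.1 z.1.
Proof.
elim: s p => [|p' s IHs] p /= /andP[/eqP pj pth] sD.
  by apply: conn_edge pj; apply: sD; rewrite mem_head.
apply: conn_trans (conn_edge (sD _ (mem_head _ _)) pj) _.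
by apply: IHs => // i iD; apply: sD; rewrite inE iD orbT.
Qed.

(** [z] stands for the pair that closes the cycle. The bound on the ends makes the edges distinct: a
    new first vertex is no end of a later edge. *)
Lemma cycle_of_path D x p : path (adjacent ends D) x p -> uniq (x :: p) ->
  exists s : seq (V * T), [/\ [seq i.1 | i <- s] = belast x p,
    {subset [seq i.2 | i <- s] <= D}, uniq [seq i.2 | i <- s],
    forall e, e \in [seq i.2 | i <- s] -> ends e \subset x :: p
    & forall z, z.1 = last x p -> sorted joins (rcons s z)].
Proof.
elim: p x => [|y p IHp] x /=; first by exists [::].
case/andP=> /adjacentP[e eD ee] pth /andP[xyp uyp].
have [s [s1 sD us send sj]] := IHp y pth uyp.
exists ((x, e) :: s); split=> /=.
- by rewrite s1.
- by move=> g; rewrite inE => /orP[/eqP-> //|/sD].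
- rewrite us andbT; apply: contra xyp => /send/subsetP; apply.
  by rewrite ee set21.
- move=> g; rewrite inE => /orP[/eqP->|/send/subsetP sg].
    by rewrite ee; apply/subsetP => i /set2P[] ->; rewrite !inE eqxx ?orbT.
  by apply/subsetP => i /sg; rewrite [in X in _ -> X]inE => ->; rewrite orbT.
move=> z ez; have := sj z ez; case: s s1 {sD us send sj} => [|[x' e'] s] /=.
  case: p ez {IHp pth xyp uyp} => //= ez _ _.
  by rewrite /joins /= ez ee eqxx.
case: p {IHp pth xyp uyp ez} => //= y' p [-> _] ->.
by rewrite /joins /= ee eqxx.
Qed.

(** A redundant edge closes a cycle with a simple path between its ends, and an edge of a cycle is
    redundant. A cycle of length 1 would be a loop, contrary to [ends_card]. *)
Lemma spanning_treeP A : spanning_tree ends A <-> minimal_spanning A.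
Proof.
split=> -[spA].
  move=> acyc; split=> // e eA spAe; have [u [v [uv ee]]] := endsP e.
  case/connectP: (spAe u v) => p0 pth0 ev; case/shortenP: pth0 ev => p pth up _ ev.
  have [s [s1 sD us _ sj]] := cycle_of_path pth up.
  apply: (acyc (rcons s (v, e))); split.
  - by case: s {s1 sD us sj}.
  - by rewrite map_rcons s1 /= ev -lastI.
  - rewrite map_rcons rcons_uniq us andbT; apply/negP => /sD.
    by rewrite !inE eqxx.
  - move=> g; rewrite map_rcons mem_rcons inE => /orP[/eqP-> //|/sD].
    by rewrite inE => /andP[].
  - have := sj (v, e) ev; case: p s s1 {pth up sD us sj} ev => [|y p] [|[x' e'] s] //=.
      by move=> _ vu; rewrite vu eqxx in uv.
    case=> -> _ _ pth'; rewrite rcons_path pth' last_rcons /joins /=.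
    by rewrite ee setUC.
move=> minA; split=> // -[|p c] [] // _ uv ue sA.
case: c uv ue sA => [|p' c] uv ue sA /=.
  rewrite andbT => /eqP ep; have := ends_card p.2.
  by rewrite ep setUid cards1.
case/andP=> /eqP ep pth.
have pA : p.2 \in A by apply: sA; rewrite mem_head.
apply: (minA p.2 pA); apply: spans_without spA ep _; rewrite connC.
apply: conn_joins pth _ => e eC; rewrite inE; apply/andP; split.
  by move: ue => /= /andP[pn _]; rewrite inE; apply: contraNneq pn => <-.
by apply: sA; rewrite /= inE eC orbT.
Qed.

End SpanningTrees.

(** * The three problems *)

Section Problems.
Local Open Scope ring_scope.
Variable R : realType.

Lemma winning_eq (T : finType) (box : (T -> R) -> Prop) feas feas' pr (Q : {set T}) v :
  (forall Q v, box v -> feas Q v <-> feas' Q v) -> box v ->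
  winning box feas pr Q v -> winning box feas' pr Q v.
Proof.
move=> e + win; elim: win => {Q v} [Q v fQ bnd bv|Q v i niQ _ IH bv].
  apply: winning_stop => [|y py]; first exact/e.
  have [by_ _] := py; have [b2 b3] := bnd y py.
  by split=> [F /(e _ _ by_)/b2|epr F /(e _ _ by_)/(b3 epr)].
by apply: (winning_query niQ) => y py; apply: IH => //; case: py.
Qed.

Lemma admissible_box (T : finType) (k : known R T) :
  exists lo hi, (forall e, lo e <= hi e) /\ admissible k = in_box lo hi.
Proof.
have ex e : exists p : R * R, p.1 <= p.2 /\
    forall t, (t \in itv_of k e) = (if p.1 < p.2 then p.1 < t < p.2 else t == p.1).
  case: (itv_ofP k e) => [[L [U eI]]|[c eI]]; rewrite eI; last first.
    exists (c, c); split=> // t; rewrite ltxx in_itv /=.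
    by rewrite eq_le andbC.
  (* The prediction shows that the open interval is nonempty, so [lo e = hi e] occurs for trivial
     intervals only. *)
  have := predictedP k e; rewrite eI in_itv /= => /andP[lt1 lt2].
  have lt := lt_trans lt1 lt2.
  by exists (L, U); split=> [|t] /=; [exact: ltW | rewrite in_itv lt].
have [lh lhP] := choice ex.
exists (fun e => (lh e).1), (fun e => (lh e).2); split=> [e|]; first by case: (lhP e).
apply/funext => x; apply/propext; split=> H e; have := H e; rewrite /in_ival;
  by have [_ ->] := lhP e.
Qed.

Section Bridges.
Variables (T : finType) (k : known R T) (lo hi : T -> R).
Hypothesis boxE : admissible k = in_box lo hi.

Let same_box x : admissible k x <-> in_box lo hi x. Proof. by rewrite boxE. Qed.

Lemma single_optimal (S : {set T}) i (x : T -> R) : i \in S ->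
  locally_optimal (singles S) [set i] x <-> forall j, j \in S -> x i <= x j.
Proof.
move=> iS; split=> [opt j jS|le e f /(exch_singles _ _ iS)[-> _ fS]]; last exact: le.
case: (eqVneq j i) => [-> //|ji]; apply: opt.
by apply/(exch_singles _ _ iS).
Qed.

Lemma single_known (S Q : {set T}) v : basis_known (singles S) lo hi Q v <->
  exists2 i, i \in S & forall x, admissible k x -> (forall j, j \in Q -> x j = v j) ->
    forall j, j \in S -> x i <= x j.
Proof.
split=> [[_ [[i iS ->] opt]]|[i iS le]].
  exists i => // x /same_box bx ex; apply/(single_optimal x iS); exact: opt.
exists [set i]; split; first by exists i.
by move=> x /same_box bx ex; apply/(single_optimal x iS); apply: le.
Qed.

Lemma solved_minimum (P : nonempty_family T) Q v : admissible k v ->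
  minima_known (Defs.family P) lo hi Q v <-> solved (pb := minimum_problem R) P k Q v.
Proof.
move=> bv; split=> [kn|[a aP] S SF].
  have ex S : exists o : option T, S \in Defs.family P -> exists2 i, o = Some i & i \in S /\
      forall x, admissible k x -> (forall j, j \in Q -> x j = v j) ->
        forall j, j \in S -> x i <= x j.
    case: (boolP (S \in Defs.family P)) => [/kn/single_known[i iS le]|_].
      by exists (Some i) => _; exists i.
    by exists None.
  have [a aP] := choice ex.
  exists a => x bx ex' S SF; have [i ei [iS le]] := aP S SF.
  by exists i => //; split=> //; apply: le.
apply/single_known; have [i ei [iS _]] := aP v bv (fun _ _ => erefl) S SF.
exists i => // x bx ex; have [j ej [_ le]] := aP x bx ex S SF.
by move: ej; rewrite ei => -[->].
Qed.

Definition comparisons (F : {set {set T}}) : {set {set T}} :=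
  [set [set p.1; p.2] | p : T * T & [exists S in F, (p.1 \in S) && (p.2 \in S)]].

Lemma comparisons_nonempty (F : {set {set T}}) : set0 \notin comparisons F.
Proof.
apply/imsetP => -[[i j] _ /= /setP/(_ i)]; by rewrite !inE eqxx.
Qed.

Lemma comparisonsP (F : {set {set T}}) S i j :
  S \in F -> i \in S -> j \in S -> [set i; j] \in comparisons F.
Proof.
move=> SF iS jS; apply/imsetP; exists (i, j) => //.
by rewrite inE; apply/exists_inP; exists S; rewrite // iS.
Qed.

(** [r] holds if the order of two elements is the same for all possible values. Known minima of
    pairs make it total on each [S], so sorting by [r] is right for all values at once; conversely,
    the positions in an answer decide each pair. *)
Lemma solved_sorting (F : input (sorting_problem R) T) Q v : admissible k v ->
  minima_known (comparisons F) lo hi Q v <-> solved (pb := sorting_problem R) F k Q v.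
Proof.
move=> bv; pose r i j := `[< forall x, admissible k x ->
  (forall j, j \in Q -> x j = v j) -> x i <= x j >].
split=> [kn|[a aP] _ /imsetP[[i j] /= + ->]].
  exists (fun S : {set T} => sort r (enum S)) => x bx ex S SF; split; first by rewrite perm_sort.
  apply: (sub_sorted (e := r)) => [i j /asboolP|]; first exact.
  apply: (sort_sorted_in (P := mem S)) => [i j iS jS|]; last first.
    by apply/allP => i; rewrite mem_enum.
  have [m /set2P[->|->] le] := (single_known _ _ _).1 (kn _ (comparisonsP SF iS jS)).
    by apply/orP; left; apply/asboolP => y by_ ey; apply: le; rewrite ?set22.
  by apply/orP; right; apply/asboolP => y by_ ey; apply: le; rewrite ?set21.
rewrite inE => /exists_inP[S SF /andP[/= iS jS]]; apply/single_known.
have mem_a m : m \in S -> m \in a S.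
  by have [/perm_mem -> _] := aP v bv (fun _ _ => erefl) S SF; rewrite mem_enum.
wlog le : i j iS jS / (index i (a S) <= index j (a S))%N => [hw|].
  case/orP: (leq_total (index i (a S)) (index j (a S))) => h; first exact: hw.
  by rewrite setUC; apply: hw.
exists i => [|x bx ex m]; first exact: set21.
case/set2P=> ->; first exact: lexx.
have [_ srt] := aP x bx ex S SF.
have tr : transitive (fun i j => x i <= x j) by move=> b c d; apply: le_trans.
have rfl : reflexive (fun i j => x i <= x j) by move=> b; apply: lexx.
exact: (sorted_leq_index tr rfl srt i j (mem_a i iS) (mem_a j jS) le).
Qed.

Lemma solved_mst (G : graph T) Q v : admissible k v ->
  basis_known (minimal_spanning (@ends T G)) lo hi Q v <->
  solved (pb := mst_problem R) G k Q v.
Proof.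
have SE := minimal_spanning_exchange (@ends_card T G).
have treeP := spanning_treeP (@ends_card T G).
have optE A x : minimal_spanning (@ends T G) A ->
    locally_optimal (minimal_spanning (@ends T G)) A x <-> mst G x A.
  move=> mA; rewrite (locally_optimalP SE x mA); split=> [opt|[_ opt] B mB].
    by split=> [|B /treeP]; [apply/treeP | apply: opt].
  by apply: opt; apply/treeP.
move=> bv; split=> -[A].
  by case=> mA opt; exists A => x /same_box bx ex; apply/optE => //; apply: opt.
move=> mstA; have mA : minimal_spanning (@ends T G) A.
  by apply/treeP; case: (mstA v bv (fun _ _ => erefl)).
by exists A; split=> // x /same_box bx ex; apply/optE => //; apply: mstA.
Qed.

End Bridges.

End Problems.

Local Open Scope ring_scope.

Theorem theorem7 (R : realType) :
  (exists A : algorithm (minimum_problem R),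
      consistent (3 / 2) A /\ robust 2 A) /\
  (exists A : algorithm (sorting_problem R),
      consistent (3 / 2) A /\ robust 2 A) /\
  (exists A : algorithm (mst_problem R),
      consistent (3 / 2) A /\ robust 2 A).
Proof.
split; [|split]; apply: algorithm_of_winning => T P k.
- have [lo [hi [lo_hi boxE]]] := admissible_box k.
  apply: (winning_eq (fun Q v => solved_minimum boxE P Q (v := v))); first exact: predictedP.
  rewrite boxE; apply: winning_minima => //; last exact: family_nonempty.
  by rewrite -boxE; apply: predictedP.
- move=> x bx; have [lo [hi [lo_hi boxE]]] := admissible_box k.
  apply/(solved_minimum boxE) => // S SF; apply: basis_knownT; last by rewrite -boxE.
  exact: singles_exist (family_nonempty P) _ SF.
- have [lo [hi [lo_hi boxE]]] := admissible_box k.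
  apply: (winning_eq (fun Q v => solved_sorting boxE P Q (v := v))); first exact: predictedP.
  rewrite boxE; apply: winning_minima => //; last exact: comparisons_nonempty.
  by rewrite -boxE; apply: predictedP.
- move=> x bx; have [lo [hi [lo_hi boxE]]] := admissible_box k.
  apply/(solved_sorting boxE) => // S SF; apply: basis_knownT; last by rewrite -boxE.
  exact: singles_exist (comparisons_nonempty P) _ SF.
- have [lo [hi [lo_hi boxE]]] := admissible_box k.
  apply: (winning_eq (fun Q v => solved_mst boxE P Q (v := v))); first exact: predictedP.
  rewrite boxE; apply: winning_basis => //.
  + exact: minimal_spanning_exchange (@ends_card T P).
  + exact: minimal_spanning_exists (@connected T P).
  by rewrite -boxE; apply: predictedP.
move=> x bx; have [lo [hi [lo_hi boxE]]] := admissible_box k.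
apply/(solved_mst boxE) => //; apply: basis_knownT; last by rewrite -boxE.
exact: minimal_spanning_exists (@connected T P).
Qed.
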